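(* Let $N\ge 1$, let $\mathbb{K}$ be a field, let $X=(x_1,\dots,x_{N-1})$ be a sequence of elements of $\mathbb{K}$, and let $Y=\mathbf 1=(1,\dots,1)$. For a permutation $\sigma\in\mathfrak{S}_N$, let $L_\sigma$ and $R_\sigma$ be the two Okada half arc-diagrams of rank $N$ associated to the pair of saturated chains obtained from $\sigma$ by Fomin's Robinson–Schensted correspondence for the Young–Fibonacci lattice. Then $$\Theta(\mathsf{E}_\sigma)=L_\sigma\Join R_\sigma .$$ Moreover $$\Theta(\mathsf{E}_\sigma)^\star=\Theta(\mathsf{E}_{\sigma^{-1}})=R_\sigma\Join L_\sigma .$$
   Context: Okada algebra. $\mathsf{O}_N(X,\mathbf 1)$ is the unital associative $\mathbb{K}$-algebra generated by $\mathsf{E}_1,\dots,\mathsf{E}_{N-1}$ with $\mathsf{E}_i^2=x_i\mathsf{E}_i$; $\mathsf{E}_i\mathsf{E}_j=\mathsf{E}_j\mathsf{E}_i$ for $|i-j|\ge2$; $\mathsf{E}_{i+1}\mathsf{E}_i\mathsf{E}_{i+1}=\mathsf{E}_{i+1}$. For $\sigma\in\mathfrak{S}_N$ put $c_i=\#\{j<i\mid\sigma^{-1}(j)>\sigma^{-1}(i)\}$ and $\mathsf{E}_\sigma=\prod_{i=1}^N\mathsf{E}_{i-1}\mathsf{E}_{i-2}\cdots\mathsf{E}_{i-c_i}$ (left to right, $i$ increasing). Okada arc-diagrams. Write $[N]=\{1,\dots,N\}$, $\overline a=-a$, $|\overline a|=a$. The node set $V_N=[N]\cup\{\overline N,\dots,\overline1\}$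 is ordered by $1<\dots<N<\overline N<\dots<\overline1$. A rank $N$ non-crossing arc-diagram is a perfect matching of $V_N$ into arcs $\{a,b\}$ ($a<b$) with no two arcs satisfying $a<c<b<d$. $\{a,b\}$ is nested in $\{c,d\}$ if $c<a<b<d$. A rank $N$ Okada arc-diagram has in addition integer labels ${\bf h}$ on arcs with (1) $1\le{\bf h}(\{a,b\})\le\min(|a|,|b|)$; (2) ${\bf h}(\{a,b\})\equiv\min(|a|,|b|)\pmod2$; (3) ${\bf h}(\{a,b\})>{\bf h}(\{c,d\})$ if $\{a,b\}$ is nested in $\{c,d\}$. $\mathfrak{A}_N$ is the set of these. The mirror $D^\star$ is obtained from $D$ by exchanging $a\leftrightarrow\overline a$ for all $a$, keeping labels. An arc is propagating if it joins a node of $[N]$ to an overlined node. Diagram algebra. For $C,D\in\mathfrak{A}_N$, $C\circ D$ is obtained by identifying the node $\overline a$ of $C$ with the node $a$ of $D$ for all $a$ and concatenating arcs; each resulting arc or loop gets as label the minimum of the labels of the arcs composing it; $[C\circ D]\in\mathfrak{A}_N$ is obtained by removing loops. $\widetilde{\mathsf{O}}_N(X,\mathbf1)$ is the $\mathbb{K}$-algebra with basis $\mathfrak{A}_N$ and product $C\cdot D=\prod_kx_k^{\ell_k}[C\circ D]$, with $\ell_k$ the number of loops of label $k$ in $C\circ D$. $\mathsf{G}_i\in\mathfrak{A}_N$ has arcs $\{j,\overline j\}$ of label $j$ for $j\neq i,i+1$, and $\{i,i+1\}$, $\{\overline i,\overline{i+1}\}$ of label $i$. $\Theta:\mathsf{O}_N(X,\mathbf1)\to\widetilde{\mathsf{O}}_N(X,\mathbf1)$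 is the algebra isomorphism with $\Theta(\mathsf{E}_i)=\mathsf{G}_i$. Half diagrams. A rank $N$ Okada half arc-diagram $H$ is what is obtained by cutting an Okada arc-diagram in the middle and keeping the left half: a set of pairwise disjoint pairs in $[N]$ (full arcs $\{a,b\}$, $a<b$), the remaining elements $a\in[N]$ carrying a (propagating) half arc, such that full arcs do not cross, no half arc node $c$ satisfies $a<c<b$ for a full arc $\{a,b\}$, and each full arc $\{a,b\}$ or half arc at $a$ has an integer label $h$ with $1\le h\le a$, $h\equiv a\pmod2$, labels being strictly larger for a full arc nested in a full arc, and for any full arc or half arc whose smallest node is greater than $c$ compared with the half arc at $c$. The propagating label set $\mathrm{PLab}(H)$ is the set of labels of the half arcs. $\langle D|$ is the half diagram of the left side of $D$ (each propagating arc with left node $a$ becomes a half arc at $a$ with the same label) and $|D\rangle=\langle D^\star|$. If $\mathrm{PLab}(L)=\mathrm{PLab}(R)$, then $L\Join R$ is the unique Okada arc-diagram with $\langle L\Join R|=L$ and $|L\Join R\rangle=R$. Young–Fibonacci lattice. A Fibonacci set of rank $n$ is a subset $S=\{s_1<\dots<s_k\}\subseteq[n]$ with $k\equiv n\pmod2$ and $s_\ell\equiv\ell\pmod2$ for all $\ell$; the rank is part of the data, and $\mathbb{YFS}$ is the disjoint union over $n$. $S\lhd T$ is a covering relation iff $S$ has rank $n-1$, $T$ has rank $n$, and one of the two sets is obtained from the other by removing its largest element. Chains. For $r\le N$ the restriction $H/[r]$ of a half diagram $H$ is the half diagram of rank $r$ whose full arcs are the full arcs of $H$ with both ends $\le r$,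 and whose half arcs are at $a$ with label $h$ whenever $H$ has a half arc at $a\le r$ with label $h$ or a full arc $\{a,b\}$ with label $h$ and $a\le r<b$. $\mathrm{Chain}(H)=(C_0,\dots,C_N)$ with $C_i=\mathrm{PLab}(H/[i])$ (of rank $i$); $\mathrm{Chain}$ is a bijection between rank $N$ half diagrams and saturated chains $\emptyset_0=C_0\lhd C_1\lhd\dots\lhd C_N$ in $\mathbb{YFS}$. Fomin's correspondence. Given $\sigma$, define Fibonacci sets $\lambda(i,j)$, $0\le i,j\le N$, by $\lambda(i,0)=\lambda(0,j)=\emptyset_0$ and, for $i,j\ge1$, with $t=\lambda(i-1,j-1)$, $x=\lambda(i-1,j)$, $y=\lambda(i,j-1)$ and $n$ the rank of $t$: if $\sigma(i)=j$ (then $x=y=t$), $\lambda(i,j)=t\cup\{n+1\}$ of rank $n+1$; if $\sigma(i)\ne j$ and $x=t$, $\lambda(i,j)=y$; if $\sigma(i)\ne j$ and $y=t$, $\lambda(i,j)=x$; if $\sigma(i)\neq j$, $x\ne t$ and $y\ne t$, $\lambda(i,j)$ is the set $t$ regarded as a Fibonacci set of rank $n+2$. Equality includes equality of ranks. The two saturated chains are $(\lambda(N,j))_{0\le j\le N}$ and $(\lambda(i,N))_{0\le i\le N}$; $L_\sigma$ and $R_\sigma$ are the half diagrams with $\mathrm{Chain}(L_\sigma)=(\lambda(N,j))_j$ and $\mathrm{Chain}(R_\sigma)=(\lambda(i,N))_i$. *)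

(* Defs.v *)
From HB Require Import structures.
From mathcomp Require Import all_boot all_order all_algebra all_fingroup.
From mathcomp Require Import zify.

Set Implicit Arguments.
Unset Strict Implicit.
Unset Printing Implicit Defensive.

Import GRing.Theory.

(* The integer a of [N] = {1, ..., N} is the ordinal a - 1 : 'I_N.
   The node a is (false, a) and the overlined node is (true, a). *)
Definition node (N : nat) : Type := (bool * 'I_N)%type.

(* Position, counted from 0, in 1 < ... < N < \overline N < ... < \overline 1. *)
Definition npos N (v : node N) : nat := if v.1 then N.*2 - v.2.+1 else v.2.

Definition nabs N (v : node N) : nat := v.2.+1.

Definition nmir N (v : node N) : node N := (~~ v.1, v.2).

(* In (p, h), the node v lies on the arc {v, p v}, whose label is h v.
   A label is at most min(|v|, |p v|) <= N, so 'I_N.+1 is large enough. *)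
Definition rawdiag (N : nat) : Type :=
  ({ffun node N -> node N} * {ffun node N -> 'I_N.+1})%type.

(* Conjuncts: labelled perfect matching; non-crossing; bounds and parity of the
   labels; larger labels on nested arcs. *)
Definition is_okada N (d : rawdiag N) : bool :=
  let p := d.1 in let h := d.2 in
  [&& [forall v, [&& p v != v, p (p v) == v & h (p v) == h v]],
      [forall a, forall c, ~~ [&& npos a < npos c, npos c < npos (p a)
                                & npos (p a) < npos (p c)]],
      [forall a, let m := minn (nabs a) (nabs (p a)) in
                 [&& 1 <= h a, h a <= m & odd (h a) == odd m]]
    & [forall a, forall c, [&& npos c < npos a, npos a < npos (p a)
                             & npos (p a) < npos (p c)] ==> (h c < h a)]].

Record okada (N : nat) : Type :=
  Okada { okada_val :> rawdiag N; okada_valP : is_okada okada_val }.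

HB.instance Definition _ N := [isSub for @okada_val N].
HB.instance Definition _ N := [Finite of okada N by <:].

Lemma npos_mir N (u : node N) : npos (nmir u) = N.*2.-1 - npos u.
Proof. by case: u => [[] [a la]]; rewrite /npos /=; lia. Qed.

Lemma npos_lt N (u : node N) : npos u < N.*2.
Proof. by case: u => [[] [a la]]; rewrite /npos /=; lia. Qed.

Lemma nmirK N : involutive (@nmir N).
Proof. by case=> b a; rewrite /nmir /= negbK. Qed.

Lemma ltn_npos_mir N (u v : node N) :
  (npos (nmir u) < npos (nmir v)) = (npos v < npos u).
Proof. rewrite !npos_mir; have := npos_lt u; have := npos_lt v; lia. Qed.

Definition rawmirror N (d : rawdiag N) : rawdiag N :=
  ([ffun v => nmir (d.1 (nmir v))], [ffun v => d.2 (nmir v)]).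

Lemma rawmirrorP N (D : okada N) : is_okada (rawmirror D).
Proof.
case: D => [[p h]] /and4P[/forallP/= H1 /forallP/= H2 /forallP/= H3 /forallP/= H4].
have Hp v : p (p v) = v by case/and3P: (H1 v) => _ /eqP.
have Hh v : h (p v) = h v by case/and3P: (H1 v) => _ _ /eqP.
apply/and4P; split; apply/forallP => /= a.
- rewrite !ffunE nmirK Hp Hh nmirK !eqxx !andbT.
  case/and3P: (H1 (nmir a)) => + _ _; apply: contra => /eqP {2}<-.
  by rewrite nmirK.
- apply/forallP => c; rewrite !ffunE.
  have := forallP (H2 (p (nmir c))) (p (nmir a)); rewrite !Hp /=
    (ltn_npos_mir (p (nmir a)) (p (nmir c))).
  have -> : (npos c < npos (nmir (p (nmir a)))) = (npos (p (nmir a)) < npos (nmir c)).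
    by rewrite -{1}[c]nmirK ltn_npos_mir.
  by rewrite -(ltn_npos_mir c a); lia.
- by rewrite !ffunE; exact: (H3 (nmir a)).
- apply/forallP => c; rewrite !ffunE.
  have := forallP (H4 (p (nmir a))) (p (nmir c)); rewrite !Hp !Hh /=
    (ltn_npos_mir (p (nmir a)) (p (nmir c))).
  have -> : (npos a < npos (nmir (p (nmir a)))) = (npos (p (nmir a)) < npos (nmir a)).
    by rewrite -{1}[a]nmirK ltn_npos_mir.
  by rewrite -(ltn_npos_mir a c); lia.
Qed.

Definition mirror N (D : okada N) : okada N := Okada (rawmirrorP D).

Definition raw_id (N : nat) : rawdiag N :=
  ([ffun v => nmir v], [ffun v => inord (nabs v)]).

Lemma raw_idP N : is_okada (raw_id N).
Proof.
apply/and4P; split; apply/forallP => /= -[a1 [a la]].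
- by rewrite !ffunE nmirK /nmir /= !eqxx andbT xpair_eqE; case: a1.
- apply/forallP => -[c1 [c lc]]; rewrite !ffunE /npos /=.
  by case: a1 c1 => [] [] /=; lia.
- by rewrite !ffunE /nabs /= minnn inordK //= leqnn eqxx.
- apply/forallP => -[c1 [c lc]]; rewrite !ffunE /npos /nabs /= !inordK //.
  by case: a1 c1 => [] [] /=; apply/implyP; lia.
Qed.

Definition id_diag (N : nat) : okada N := Okada (raw_idP N).

(* insubd a k is k seen in 'I_N: the arcs of label i are {i, i+1} on each side. *)
Definition raw_gen (N i : nat) : rawdiag N :=
  ([ffun v : node N => if nabs v == i then (v.1, insubd v.2 i)
                       else if nabs v == i.+1 then (v.1, insubd v.2 i.-1)
                       else nmir v],
   [ffun v : node N => if nabs v == i.+1 then inord i else inord (nabs v)]).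

Lemma raw_genP N i : 0 < i < N -> is_okada (raw_gen N i).
Proof.
move=> iN.
have q1 v : ((raw_gen N i).1 v).1 =
    if (nabs v == i) || (nabs v == i.+1) then v.1 else ~~ v.1.
  by rewrite /= ffunE; case: eqP => //= _; case: eqP.
have q2 v : ((raw_gen N i).1 v).2 =
    (if nabs v == i then i else if nabs v == i.+1 then i.-1 else v.2) :> nat.
  rewrite /= ffunE; case: eqP => /= [_|_].
    by rewrite val_insubd; case/andP: iN => _ ->.
  case: eqP => //= _; rewrite val_insubd.
  by have -> : i.-1 < N by lia.
have hE v : (raw_gen N i).2 v = (if nabs v == i.+1 then i else nabs v) :> nat.
  rewrite /= ffunE; case: eqP => _; rewrite inordK //; last exact: ltn_ord v.2.
  by lia.
have nE (u v : node N) : u.1 = v.1 -> u.2 = v.2 :> nat -> u = v.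
  by case: u v => [? ?] [? ?] /= -> /val_inj ->.
case: (raw_gen N i) q1 q2 hE => p h /= q1 q2 hE.
apply/and4P; split; apply/forallP => a.
- have qa1 := q1 a; have qa2 := q2 a; apply/and3P; split.
  + apply/eqP => e; move: qa1 qa2; rewrite e /nabs.
    case: (a) => [[] [k lk]] /=; do ![case: eqP => ? //=]; lia.
  + apply/eqP/nE; rewrite ?q1 ?q2 /nabs ?qa1 ?qa2 /nabs;
    case: (a) => [b [k lk]] /=;
    (case: (k.+1 =P i) => ? /=; [|case: (k.+1 =P i.+1) => ? /=]);
    do ![case: eqP => ? //=]; rewrite ?negbK //; lia.
  + apply/eqP/val_inj; rewrite /= !hE /nabs qa2 /nabs.
    case: (a) => [b [k lk]] /=;
    (case: (k.+1 =P i) => ? /=; [|case: (k.+1 =P i.+1) => ? /=]);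
    do ![case: eqP => ? //=]; lia.
- apply/forallP => c.
  move: (q1 a) (q2 a) (q1 c) (q2 c).
  move: (p a) (p c) => [b1 [k1 l1]] [b2 [k2 l2]] /=.
  rewrite /npos /nabs; case: a c => [ba [ka la]] [bc [kc lc]] /= -> -> -> ->.
  by case: ba bc => [] [] /=; do ![case: eqP => ? //=]; lia.
- rewrite /= !hE /nabs q2 /nabs.
  case: a => [ba [k la]] /=;
  (case: (k.+1 =P i) => ? /=; [|case: (k.+1 =P i.+1) => ? /=]);
  do ![case: eqP => ? //=]; lia.
- apply/forallP => c; rewrite !hE.
  move: (q1 a) (q2 a) (q1 c) (q2 c).
  move: (p a) (p c) => [b1 [k1 l1]] [b2 [k2 l2]] /=.
  rewrite /npos /nabs; case: a c => [ba [ka la]] [bc [kc lc]] /= -> -> -> ->.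
  by apply/implyP; case: ba bc => [] [] /=; do ![case: eqP => ? //=]; lia.
Qed.

Definition gen_diag (N i : nat) (iN : 0 < i < N) : okada N := Okada (raw_genP iN).

(* (false, v) is the node v of C and (true, v) is the node v of D. *)
Definition gnode (N : nat) : Type := (bool * node N)%type.

Section Composition.
Variables (N : nat) (C D : rawdiag N).

Definition gdiag (u : gnode N) : rawdiag N := if u.1 then D else C.

Definition garc (u : gnode N) : gnode N := (u.1, (gdiag u).1 u.2).

Definition glabel (u : gnode N) : 'I_N.+1 := (gdiag u).2 u.2.

(* The overlined nodes of C and the plain nodes of D are identified pairwise. *)
Definition glued (u : gnode N) : bool := u.1 != u.2.1.

Definition gedge : rel (gnode N) :=
  [rel u v | (v == garc u) || (glued u && (v == (~~ u.1, nmir u.2)))].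

Definition strand (u : gnode N) : {set gnode N} := [set v | connect gedge u v].

Definition strand_label (u : gnode N) : 'I_N.+1 :=
  glabel [arg min_(v < u in strand u) glabel v].

Definition outer (w : node N) : gnode N := (w.1, w).

(* [C o D]; pick returns the other end of the strand of w. *)
Definition compose : rawdiag N :=
  ([ffun w => odflt w [pick w' | (w' != w) && (outer w' \in strand (outer w))]],
   [ffun w => strand_label (outer w)]).

(* Loops are the strands without outer nodes. *)
Definition nloops (k : nat) : nat :=
  #|[set strand u | u : gnode N & [forall w, outer w \notin strand u]
                                  && (strand_label u == k :> nat)]|.

End Composition.

Local Open Scope ring_scope.

(* The space with basis the Okada arc-diagrams; the pointwise product of
   {ffun _} is deliberately not inherited. *)
Definition dalg (K : fieldType) (N : nat) : Type := {ffun okada N -> K^o}.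

HB.instance Definition _ K N :=
  GRing.Lmodule.copy (dalg K N) {ffun okada N -> K^o}.

Definition dbasis (K : fieldType) N (D : okada N) : dalg K N :=
  [ffun D' => (D' == D)%:R : K^o].

(* Bilinear extension of C . D = \prod_k x_k ^ l_k [C o D]; as [C o D] is always
   an Okada arc-diagram, no pair (C, D) is lost.  Only x 1, ..., x (N - 1) are
   used, here and below. *)
Definition dmul (K : fieldType) N (x : nat -> K) (f g : dalg K N) : dalg K N :=
  [ffun D => (\sum_(CC : okada N * okada N | compose CC.1 CC.2 == okada_val D)
     f CC.1 * g CC.2 * \prod_(1 <= k < N) x k ^+ nloops CC.1 CC.2 k) : K^o].

(* The linear extension of the involution D |-> D*. *)
Definition dstar (K : fieldType) N (f : dalg K N) : dalg K N :=
  [ffun D => f (mirror D)].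

Definition okada_relations (K : fieldType) N (x : nat -> K) (A : algType K)
    (E : nat -> A) : Prop :=
  [/\ forall i, (0 < i < N)%N -> E i * E i = x i *: E i,
      forall i j, (0 < i < N)%N -> (0 < j < N)%N -> (i + 2 <= j)%N || (j + 2 <= i)%N ->
        E i * E j = E j * E i
    & forall i, (0 < i)%N -> (i.+1 < N)%N -> E i.+1 * E i * E i.+1 = E i.+1].

(* A, with the generators E 1, ..., E (N - 1), is the algebra presented by the
   relations above: it is initial among the algebras in which they hold. *)
Definition is_okada_algebra (K : fieldType) N (x : nat -> K) (A : algType K)
    (E : nat -> A) : Prop :=
  okada_relations N x E /\
  forall (B : algType K) (F : nat -> B), okada_relations N x F ->
    exists f : {lrmorphism A -> B},
      (forall i, (0 < i < N)%N -> f (E i) = F i) /\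
      forall g : {lrmorphism A -> B},
        (forall i, (0 < i < N)%N -> g (E i) = F i) -> g =1 f.

Definition is_okada_iso (K : fieldType) N (x : nat -> K) (A : algType K)
    (E : nat -> A) (Theta : {linear A -> dalg K N}) : Prop :=
  [/\ bijective Theta,
      Theta 1 = dbasis K (id_diag N),
      forall a b, Theta (a * b) = dmul x (Theta a) (Theta b)
    & forall i (iN : (0 < i < N)%N), Theta (E i) = dbasis K (gen_diag iN)].

(* With i0 = i - 1, this is c_i. *)
Definition inv_code N (s : 'S_N) (i0 : 'I_N) : nat :=
  #|[set j : 'I_N | (j < i0)%N && ((s^-1)%g i0 < (s^-1)%g j)%N]|.

(* The factor of index i = i0 + 1 is E (i-1) * E (i-2) * ... * E (i - c_i). *)
Definition okada_word N (s : 'S_N) (A : pzRingType) (E : nat -> A) : A :=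
  \prod_(i0 < N) \prod_(k < inv_code s i0) E (i0 - k)%N.

Local Close Scope ring_scope.

(* In (p, h), a is the left or right end of the full arc {a, p a} if p a != a,
   and carries a half arc if p a = a; in both cases the label is h a. *)
Definition rawhalf (N : nat) : Type :=
  ({ffun 'I_N -> 'I_N} * {ffun 'I_N -> 'I_N.+1})%type.

Definition is_half N (H : rawhalf N) : bool :=
  let p := H.1 in let h := H.2 in
  [&& [forall a : 'I_N, (p (p a) == a) && (h (p a) == h a)],
      [forall a : 'I_N, forall c : 'I_N, ~~ [&& a < c, c < p a & p a < p c]],
      [forall a : 'I_N, forall c : 'I_N, (p c == c) ==> ~~ (a < c < p a)],
      [forall a : 'I_N, let m := (minn a (p a)).+1 in
                 [&& 1 <= h a, h a <= m & odd (h a) == odd m]],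
      [forall a : 'I_N, forall c : 'I_N, [&& c < a, a < p a & p a < p c] ==> (h c < h a)]
    & [forall a : 'I_N, forall c : 'I_N, (p c == c) && (c < minn a (p a)) ==> (h c < h a)]].

Record halfdiag (N : nat) : Type :=
  Half { half_val :> rawhalf N; half_valP : is_half half_val }.

HB.instance Definition _ N := [isSub for @half_val N].
HB.instance Definition _ N := [Finite of halfdiag N by <:].

(* The increasing list of the labels of the half arcs. *)
Definition plab N (H : rawhalf N) : seq nat :=
  [seq l <- iota 1 N | [exists a, (H.1 a == a) && (H.2 a == l :> nat)]].

Definition left_half N (d : rawdiag N) : rawhalf N :=
  ([ffun a => let w := d.1 (false, a) in if w.1 then a else w.2],
   [ffun a => d.2 (false, a)]).

Definition right_half N (D : okada N) : rawhalf N := left_half (mirror D).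

(* D = L \Join R *)
Definition is_join N (L R : halfdiag N) (D : okada N) : Prop :=
  plab L = plab R /\
  unique (fun D' : okada N => left_half D' = L /\ right_half D' = R) D.

(* H / [r]: insubd a b is b if b is in [r], and a otherwise. *)
Definition restrict N r (rN : r <= N) (H : rawhalf N) : rawhalf r :=
  ([ffun a => insubd a (val (H.1 (widen_ord rN a)))],
   [ffun a => inord (val (H.2 (widen_ord rN a)))]).

(* (n, s) is the set of rank n whose increasing enumeration is s. *)
Definition is_fib (S : nat * seq nat) : bool :=
  [&& sorted ltn S.2, all (fun a => 0 < a <= S.1) S.2, odd (size S.2) == odd S.1
    & all (fun l => odd (nth 0 S.2 l) == odd l.+1) (iota 0 (size S.2))].

Record fib : Type := Fib { fib_val :> nat * seq nat; fib_valP : is_fib fib_val }.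

HB.instance Definition _ := [isSub for fib_val].
HB.instance Definition _ := [Equality of fib by <:].

Definition fib0 : fib := @Fib (0, [::]) isT.

Lemma fib_addP (t : fib) : is_fib ((val t).1.+1, rcons (val t).2 (val t).1.+1).
Proof.
case: t => [[n s]] /= /and4P[/= srt bnd par alt]; apply/and4P; split=> /=.
- case: s srt bnd {par alt} => //= a s; rewrite rcons_path => -> /=.
  case/andP=> /andP[_ an] /allP bnd; have := mem_last a s.
  by rewrite inE => /orP[/eqP->|/bnd/andP[_]]; rewrite ltnS.
- by rewrite all_rcons /= leqnn; apply: sub_all bnd => a; lia.
- by rewrite size_rcons /= (eqP par).
- rewrite size_rcons -[(size s).+1]addn1 iotaD all_cat /= nth_rcons ltnn eqxx /= (eqP par).
  rewrite eqxx !andbT; apply/allP => l; rewrite mem_iota /= => ls.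
  by rewrite nth_rcons ls; apply: (allP alt); rewrite mem_iota.
Qed.

Lemma fib_raiseP (t : fib) : is_fib ((val t).1.+2, (val t).2).
Proof.
case: t => [[n s]] /= /and4P[/= srt bnd par alt]; apply/and4P; split=> //=.
- by apply: sub_all bnd => a; lia.
- by rewrite negbK.
Qed.

(* t with the element n + 1 added, of rank n + 1, and t in rank n + 2. *)
Definition fib_add (t : fib) : fib := Fib (fib_addP t).
Definition fib_raise (t : fib) : fib := Fib (fib_raiseP t).

Definition growth (marked : bool) (t x y : fib) : fib :=
  if marked then fib_add t
  else if x == t then y
  else if y == t then x
  else fib_raise t.

(* sigma (i0 + 1) = j0 + 1 *)
Definition marked N (s : 'S_N) (i0 j0 : nat) : bool :=
  [exists k : 'I_N, (k == i0 :> nat) && (s k == j0 :> nat)].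

Fixpoint lambda N (s : 'S_N) (i : nat) : nat -> fib :=
  match i with
  | 0 => fun _ => fib0
  | i0.+1 => fix row (j : nat) : fib :=
      match j with
      | 0 => fib0
      | j0.+1 => growth (marked s i0 j0)
                   (lambda s i0 j0) (lambda s i0 j0.+1) (row j0)
      end
  end.

(* Chain(H) = (c_0, ..., c_N) *)
Definition has_chain N (H : halfdiag N) (c : nat -> fib) : Prop :=
  forall i (iN : i <= N), (i, plab (restrict iN H)) = val (c i).

(* L_sigma and R_sigma *)
Definition is_fomin_left N (s : 'S_N) (L : halfdiag N) : Prop :=
  unique (fun H => has_chain H (fun j => lambda s N j)) L.

Definition is_fomin_right N (s : 'S_N) (R : halfdiag N) : Prop :=
  unique (fun H => has_chain H (fun i => lambda s i N)) R.

(* Main.v *)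
(* E_sigma is built factor by factor: let D be the image of the product of the
   first m factors, which is the identity above m.  Multiplying D by G_m ... G_k
   inserts an innermost arc {k, k + 1} of label k among the overlined nodes and
   shifts the middle of D by one node.  Hence the left chain gets one new member,
   and the right chain C becomes C_0, ..., C_(k-1), C_(k-1) + {k}, C_(k-1), C_k, ...
   If k - 1 is the number of values at most m placed before m + 1 in sigma, these
   are the growth rules in column m + 1 of Fomin's diagram.  No loop is created, so
   the x_i do not matter.  As Chain is injective on half diagrams and a diagram is
   determined by its halves, the first claim follows; the second one comes from the
   symmetry of the growth rules under sigma |-> sigma^-1. *)
Require Import Defs.
From mathcomp Require Import all_boot all_order all_algebra all_fingroup.
From mathcomp Require Import zify.

Set Implicit Arguments.
Unset Strict Implicit.
Unset Printing Implicit Defensive.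

Import GRing.Theory.

(** Only a restricted kind of product occurs. Whenever $G_k$ is applied, the overlined node $k+1$
    carries its largest possible label $k+1$, and it is joined to the overlined node $k+2$ or, for
    the first generator of a factor, to the plain node $k+1$. So it is not joined to the overlined
    node $k$, which excludes loops, and it never decides a minimum: the joined arc inherits the
    label found at the overlined node $k$. This turns composition into the explicit [surgery].
    Chains are handled through [cut], the labels of the arcs that leave an initial segment of one
    side; the effect of a surgery on a cut depends only on which of the affected nodes lie in the
    segment. The two sides are tied together where the diagram becomes the identity: there the same
    arcs leave both segments, so the new member of the left chain is read off the right one. On
    Fomin's side, ranks count points of the permutation and decide which growth rule applies. *)

Lemma npos_inj N : injective (@npos N).
Proof.
move=> [[] [a la]] [[] [b lb]]; rewrite /npos /= => e;
by [congr (_, _); apply: val_inj => /=; lia | lia].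
Qed.

(** * Arcs and labels of an Okada arc-diagram *)

Section OkadaFacts.
Variables (N : nat) (d : rawdiag N).
Hypothesis okd : is_okada d.

Lemma arcK : involutive d.1.
Proof. by move=> v; case/and4P: okd => /forallP/(_ v)/and3P[_ /eqP]. Qed.

Lemma arc_eq u w : (d.1 w == u) = (w == d.1 u).
Proof. exact: (can2_eq arcK arcK). Qed.

Lemma arc_neq v : d.1 v != v.
Proof. by case/and4P: okd => /forallP/(_ v)/and3P[]. Qed.

Lemma label_arc v : d.2 (d.1 v) = d.2 v.
Proof. by case/and4P: okd => /forallP/(_ v)/and3P[_ _ /eqP]. Qed.

Lemma arc_noncrossing a c :
  ~~ [&& npos a < npos c, npos c < npos (d.1 a) & npos (d.1 a) < npos (d.1 c)].
Proof. by case/and4P: okd => _ /forallP/(_ a)/forallP/(_ c). Qed.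

Lemma label_bounds a : let m := minn (nabs a) (nabs (d.1 a)) in
  [&& 1 <= d.2 a, d.2 a <= m & odd (d.2 a) == odd m].
Proof. by case/and4P: okd => _ _ /forallP/(_ a). Qed.

Lemma label_le v : d.2 v <= v.2.+1.
Proof. by move: (label_bounds v); rewrite /nabs /=; lia. Qed.

Lemma label_nested a c :
  [&& npos c < npos a, npos a < npos (d.1 a) & npos (d.1 a) < npos (d.1 c)] ->
  d.2 c < d.2 a.
Proof. by case/and4P: okd => _ _ _ /forallP/(_ a)/forallP/(_ c)/implyP. Qed.

End OkadaFacts.

(* The diagram d G_i, for u and v the overlined nodes i and i + 1 and l = i: the
   other ends of the arcs of d at u and v are joined, and {u, v} becomes an arc.
   Its label d.2 u is the smaller one when the label of v in d is i + 1. *)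
Definition surgery N (d : rawdiag N) (u v : node N) (l : nat) : rawdiag N :=
  ([ffun w => if w == u then v else if w == v then u else
              if w == d.1 u then d.1 v else if w == d.1 v then d.1 u else d.1 w],
   [ffun w => if (w == u) || (w == v) then inord l else
              if w == d.1 v then d.2 u else d.2 w]).

(** * Composition with one generator *)

Section RightMultiplication.
Variables (N : nat) (d : rawdiag N) (a b : 'I_N).
Hypotheses (okd : is_okada d) (ab : b = a.+1 :> nat).
Let A : node N := (true, a).
Let B : node N := (true, b).
Hypotheses (noloop : d.1 A != B) (labB : d.2 B = b.+1 :> nat).
Let d' := surgery d A B b.

Lemma neq_AB : A != B.
Proof. by apply/eqP => -[] /(congr1 val) /=; lia. Qed.

Lemma arc_A_neqs : [/\ d.1 A != A, d.1 B != A, d.1 B != B & d.1 A != d.1 B].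
Proof.
split; try exact: arc_neq.
- by apply: contra noloop => /eqP <-; rewrite arcK.
- by rewrite (inj_eq (can_inj (arcK okd))) neq_AB.
Qed.

(** In these names, $U$ and $V$ are the far ends [d.1 A] and [d.1 B] of the two arcs that get
    joined. *)
Variant surgery_spec (w : node N) : node N -> nat -> Prop :=
  | SurgeryA of w = A : surgery_spec w B b
  | SurgeryB of w = B : surgery_spec w A b
  | SurgeryU of w = d.1 A & w != A & w != B : surgery_spec w (d.1 B) (d.2 A)
  | SurgeryV of w = d.1 B & w != A & w != B & w != d.1 A : surgery_spec w (d.1 A) (d.2 A)
  | SurgeryOther of w != A & w != B & w != d.1 A & w != d.1 B :
      surgery_spec w (d.1 w) (d.2 w).

Lemma surgeryP w : surgery_spec w (d'.1 w) (d'.2 w).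
Proof.
have [/negbTE h1 /negbTE h2 /negbTE h3 /negbTE h4] := arc_A_neqs.
have bE : (inord b : 'I_N.+1) = b :> nat by rewrite inordK // ltnS ltnW.
rewrite !ffunE.
have [eA|nA] := eqVneq w A; first by rewrite /= bE; constructor.
have [eB|nB] := eqVneq w B; first by rewrite /= bE; constructor.
have [eU|nU] /= := eqVneq w (d.1 A).
  by rewrite eU h4 label_arc //; constructor; rewrite -?eU.
by have [eV|nV] /= := eqVneq w (d.1 B); constructor.
Qed.

Lemma surgery_arcA : d'.1 A = B.
Proof. by rewrite ffunE eqxx. Qed.

Lemma surgery_arcB : d'.1 B = A.
Proof. by rewrite ffunE eqxx eq_sym (negbTE neq_AB). Qed.

Lemma surgery_arcU : d'.1 (d.1 A) = d.1 B.
Proof.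
case: arc_A_neqs => /negbTE h1 /negbTE h2 /negbTE h3 /negbTE h4.
by rewrite ffunE h1 (negbTE noloop) eqxx.
Qed.

Lemma surgery_arcV : d'.1 (d.1 B) = d.1 A.
Proof.
case: arc_A_neqs => /negbTE h1 /negbTE h2 /negbTE h3 /negbTE h4.
by rewrite ffunE h2 h3 eq_sym h4 eqxx.
Qed.

Lemma surgery_labelA : d'.2 A = b :> nat.
Proof. by rewrite ffunE eqxx inordK // ltnS ltnW. Qed.

Lemma surgery_labelB : d'.2 B = b :> nat.
Proof. by rewrite ffunE eqxx orbT inordK // ltnS ltnW. Qed.

Lemma surgery_labelU : d'.2 (d.1 A) = d.2 A.
Proof.
case: arc_A_neqs => /negbTE h1 /negbTE h2 /negbTE h3 /negbTE h4.
by rewrite ffunE h1 (negbTE noloop) h4 label_arc.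
Qed.

Lemma surgery_labelV : d'.2 (d.1 B) = d.2 A.
Proof.
case: arc_A_neqs => /negbTE h1 /negbTE h2 /negbTE h3 /negbTE h4.
by rewrite ffunE h2 h3 eqxx.
Qed.

Lemma surgery_other w : w != A -> w != B -> w != d.1 A -> w != d.1 B ->
  d'.1 w = d.1 w /\ d'.2 w = d.2 w.
Proof.
by move=> /negbTE h1 /negbTE h2 /negbTE h3 /negbTE h4; rewrite !ffunE h1 h2 h3 h4.
Qed.

Lemma surgery_other_arc w : w != A -> w != B -> w != d.1 A -> w != d.1 B ->
  d'.1 (d.1 w) = w /\ d'.2 (d.1 w) = d.2 w.
Proof.
move=> hA hB hU hV.
have [] := @surgery_other (d.1 w); rewrite ?arc_eq ?arcK ?label_arc //.
Qed.

Lemma surgery_invol : involutive d'.1.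
Proof.
move=> w; case: (surgeryP w) => [->|->|->|->|hA hB hU hV].
- exact: surgery_arcB.
- exact: surgery_arcA.
- by move=> _ _; exact: surgery_arcV.
- by move=> _ _ _; exact: surgery_arcU.
- by case: (surgery_other_arc hA hB hU hV).
Qed.

Lemma surgery_label_arc w : d'.2 (d'.1 w) = d'.2 w.
Proof.
apply: val_inj => /=.
have [eA|nA] := eqVneq w A; first by rewrite eA surgery_arcA surgery_labelA surgery_labelB.
have [eB|nB] := eqVneq w B; first by rewrite eB surgery_arcB surgery_labelA surgery_labelB.
have [eU|nU] := eqVneq w (d.1 A); first by rewrite eU surgery_arcU surgery_labelU surgery_labelV.
have [eV|nV] := eqVneq w (d.1 B); first by rewrite eV surgery_arcV surgery_labelU surgery_labelV.
have [-> ->] := surgery_other nA nB nU nV.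
by have [_ ->] := surgery_other_arc nA nB nU nV.
Qed.

Lemma surgery_arc_neq w : d'.1 w != w.
Proof.
have [h1 h2 h3 h4] := arc_A_neqs.
case: (surgeryP w) => [->|->|->|->|hA hB hU hV]; rewrite ?neq_AB //.
- by rewrite eq_sym neq_AB.
- by move=> _ _; rewrite eq_sym.
- by rewrite arc_neq.
Qed.

Let g := raw_gen N b.

Lemma gen_arcP (w : node N) : g.1 w =
  if w.2 == a then (w.1, b) else if w.2 == b then (w.1, a) else nmir w.
Proof.
have lb := ltn_ord b; case: w => s c; rewrite ffunE /nabs /= -!val_eqE /=.
have -> : (c.+1 == b) = (c == a :> nat) by rewrite ab eqSS.
rewrite eqSS; case: eqP => [e|_]; first by congr (_, _); apply: val_inj; rewrite val_insubd lb.
case: eqP => [e|_ //]; congr (_, _); apply: val_inj; rewrite val_insubd ab /=.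
by rewrite ltn_ord.
Qed.

Lemma gen_labelE (w : node N) : g.2 w = (if w.2 == b then b : nat else w.2.+1) :> nat.
Proof.
case: w => s c; rewrite ffunE /nabs /= -val_eqE eqSS /=.
by case: eqP => [e|_]; rewrite inordK // ltnS // ltnW.
Qed.

(* The two outer nodes of the strand of x in the composite. *)
Definition strand_ends (x : gnode N) : {set node N} :=
  let ends w := if (w == A) || (w == B) then [set d.1 A; d.1 B] else [set w; d'.1 w] in
  if x.1 then (if x.2.1 then [set x.2; d'.1 x.2] else ends (true, x.2.2)) else ends x.2.

(** The expected ends form an invariant of the glued graph, which bounds each strand from above
    without describing it as a path. *)
Lemma strand_ends_edge x y : gedge d g x y -> strand_ends x = strand_ends y.
Proof.
have [/negbTE h1 /negbTE h2 /negbTE h3 /negbTE h4] := arc_A_neqs.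
have nU := negbTE noloop.
case: x => [[] [s c]] /orP[/eqP->|/andP[]].
- rewrite /garc /gdiag /= gen_arcP /= /strand_ends /=.
  have [->|ca] := eqVneq c a; last have [->|cb] := eqVneq c b.
  + by case: s => //=; rewrite ?eqxx ?orbT // -/A -/B surgery_arcA surgery_arcB setUC.
  + by case: s => //=; rewrite ?eqxx ?orbT // -/A -/B surgery_arcA surgery_arcB setUC.
  + by case: s => //=; rewrite !xpair_eqE (negbTE ca) (negbTE cb).
- by case: s => // _ /eqP ->.
- rewrite /garc /gdiag /strand_ends /=; move: (s, c) => w.
  case: (surgeryP w) => [->|->|->|->|hA hB hU hV].
  + by rewrite eqxx h1 nU surgery_arcU.
  + by rewrite eqxx orbT h2 h3 surgery_arcV setUC.
  + by move=> _ _; rewrite h1 nU arcK // eqxx.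
  + by move=> _ _ _; rewrite h2 h3 arcK // eqxx orbT setUC.
  + rewrite !arc_eq // (negbTE hA) (negbTE hB) (negbTE hU) (negbTE hV) /=.
    by rewrite (surgery_other_arc hA hB hU hV).1 setUC.
- by case: s => // _ /eqP ->.
Qed.

Lemma strand_ends_connect x w : w \in strand_ends x -> connect (gedge d g) x (outer w).
Proof.
have [/negbTE h1 /negbTE h2 /negbTE h3 /negbTE h4] := arc_A_neqs.
have nU := negbTE noloop.
have cC v : connect (gedge d g) (false, v) (false, d.1 v).
  by apply: connect1; apply/orP; left; rewrite /garc eqxx.
have cG v : connect (gedge d g) (true, v) (true, g.1 v).
  by apply: connect1; apply/orP; left; rewrite /garc eqxx.
have cJ c : connect (gedge d g) (false, (true, c)) (true, (false, c)).
  by apply: connect1; apply/orP; right; rewrite /glued eqxx.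
have cJ' c : connect (gedge d g) (true, (false, c)) (false, (true, c)).
  by apply: connect1; apply/orP; right; rewrite /glued eqxx.
have cO v : v != A -> v != B -> connect (gedge d g) (false, v) (outer v).
  case: v => [[] c]; last by rewrite connect0.
  rewrite !xpair_eqE /= => ca cb; apply: connect_trans (cJ c) _.
  by have := cG (false, c); rewrite gen_arcP /= (negbTE ca) (negbTE cb).
(* From $U$ along the old arc to [A], across the generator's arc to [B], then along the old arc to
   $V$. *)
have cU : connect (gedge d g) (false, d.1 A) (outer (d.1 B)).
  have := cC (d.1 A); rewrite arcK // => /connect_trans; apply.
  apply: connect_trans (cJ a) _; apply: connect_trans (cG (false, a)) _.
  rewrite gen_arcP /= eqxx; apply: connect_trans (cJ' b) _.
  by apply: connect_trans (cC B) _; rewrite cO ?h2 ?h3.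
have cV : connect (gedge d g) (false, d.1 B) (outer (d.1 A)).
  have := cC (d.1 B); rewrite arcK // => /connect_trans; apply.
  apply: connect_trans (cJ b) _; apply: connect_trans (cG (false, b)) _.
  rewrite gen_arcP /= eqxx -val_eqE /= ab (gtn_eqF (ltnSn a)).
  apply: connect_trans (cJ' a) _.
  by apply: connect_trans (cC A) _; rewrite cO ?h1 ?nU.
have cI v : w \in (if (v == A) || (v == B) then [set d.1 A; d.1 B] else [set v; d'.1 v]) ->
    connect (gedge d g) (false, v) (outer w).
  case: (surgeryP v) => [->|->|->|->|hA hB hU hV].
  - rewrite eqxx !inE => /orP[] /eqP ->.
      by apply: connect_trans (cC A) _; rewrite cO ?h1 ?nU.
    have := cC A => /connect_trans; apply; exact: cU.
  - rewrite eqxx orbT !inE => /orP[] /eqP ->; last first.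
      by apply: connect_trans (cC B) _; rewrite cO ?h2 ?h3.
    have := cC B => /connect_trans; apply; exact: cV.
  - by move=> _ _; rewrite h1 nU !inE => /orP[] /eqP -> //; rewrite cO ?h1 ?nU.
  - by move=> _ _ _; rewrite h2 h3 !inE => /orP[] /eqP -> //; rewrite cO ?h2 ?h3.
  - rewrite (negbTE hA) (negbTE hB) !inE => /orP[] /eqP ->; first exact: cO.
    by apply: connect_trans (cC v) _; apply: cO; rewrite arc_eq.
case: x => [[] v] /=; rewrite /strand_ends /=; last exact: cI.
case: v => [[] c] /=; last by move/cI; apply: connect_trans; exact: cJ'.
rewrite !inE => /orP[/eqP -> //|/eqP we].
have := cG (true, c); rewrite gen_arcP /=.
have [ca|ca] := eqVneq c a; first by rewrite we ca -/A surgery_arcA.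
have [cb|cb] := eqVneq c b; first by rewrite we cb -/B surgery_arcB.
move=> cc; apply: connect_trans cc _; apply: connect_trans (cJ' c) _.
by apply: cI; rewrite !xpair_eqE (negbTE ca) (negbTE cb) !inE we eqxx orbT.
Qed.

Lemma strand_ends_outer w : strand_ends (outer w) = [set w; d'.1 w].
Proof. by case: w => [[] c]. Qed.

(** Invariance of [strand_ends] along paths gives one direction, the explicit walks of
    [strand_ends_connect] the other, reversed by the symmetry of [gedge]. *)
Lemma mem_strand_outer x w : (x \in strand d g (outer w)) = (w \in strand_ends x).
Proof.
have sym : symmetric (gedge d g).
  have gK : involutive g.1 by apply/arcK/raw_genP; rewrite ltn_ord ab.
  have aK : involutive (garc d g).
    by case=> [[] v]; rewrite /garc /gdiag /= ?gK ?arcK.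
  have sub y z : gedge d g y z -> gedge d g z y.
    case/orP=> [/eqP->|/andP[gy /eqP->]]; apply/orP; first by left; rewrite aK.
    right; move: gy; rewrite /glued /= nmirK negbK -surjective_pairing eqxx.
    by case: y => [[] [[] c]].
  by move=> y z; apply/idP/idP; exact: sub.
rewrite inE; apply/idP/idP => [/connectP[p]|/strand_ends_connect]; last first.
  by rewrite (sym_connect_sym sym).
elim/last_ind: p x => [|p y IHp] x /=.
  by move=> _ ->; rewrite strand_ends_outer !inE eqxx.
rewrite rcons_path last_rcons => /andP[pp e] ->.
by rewrite -(strand_ends_edge e); apply: IHp.
Qed.

(** On the strand from $U$ to $V$ the minimum is attained at [A]: its label is at most $b$, the
    label of the generator's arc, while that of [B] is $b+1$. The vertical arcs of the generator
    carry the largest label their nodes admit, so they never lower a minimum. *)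
Lemma strand_label_surgery w : strand_label d g (outer w) = d'.2 w :> nat.
Proof.
have [h1 h2 h3 h4] := arc_A_neqs.
have lb := ltn_ord b.
have hA : d.2 A <= a.+1 by exact: label_le.
have lU : d.2 (d.1 A) = d.2 A by rewrite label_arc.
have lV : d.2 (d.1 B) = d.2 B by rewrite label_arc.
rewrite /strand_label; case: arg_minnP => [|x].
  by rewrite mem_strand_outer strand_ends_outer !inE eqxx.
rewrite mem_strand_outer => wx min_x; apply/eqP; rewrite eqn_leq; apply/andP; split.
  (* A node of the strand with the expected label bounds the minimum from above; the remaining steps
     show that no node of the strand has less. *)
  have [y yw <-] : exists2 y, w \in strand_ends y & glabel d g y = d'.2 w :> nat.
    case: (surgeryP w) => [->|->|-> _ _|-> _ _ _|wA wB wU wV].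
    - exists (outer A); first by rewrite strand_ends_outer !inE eqxx.
      by rewrite /glabel /= gen_labelE; case: eqP => //= /(congr1 val) /=; lia.
    - exists (outer B); first by rewrite strand_ends_outer !inE eqxx.
      by rewrite /glabel /= gen_labelE eqxx.
    - exists (false, A); last by [].
      by rewrite /strand_ends /= eqxx !inE eqxx.
    - exists (false, A); last by [].
      by rewrite /strand_ends /= eqxx !inE eqxx orbT.
    - exists (false, w); last by [].
      by rewrite /strand_ends /= (negbTE wA) (negbTE wB) !inE eqxx.
  by apply: min_x; rewrite mem_strand_outer.
have pair_label v u : u \in [set v; d'.1 v] -> d'.2 u = d'.2 v.
  by rewrite !inE => /orP[] /eqP ->; rewrite ?surgery_label_arc.
have UV_label u : u \in [set d.1 A; d.1 B] -> d'.2 u = d.2 A.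
  by rewrite !inE => /orP[] /eqP ->; rewrite ?surgery_labelU ?surgery_labelV.
have label_other v : v != A -> v != B -> d'.2 v <= d.2 v.
  case: (surgeryP v) => [->|->|-> _ _|-> _ _ _|//]; rewrite ?eqxx ?lU ?lV ?labB //.
  by move=> _ _; lia.
case: x wx {min_x} => [[] [s c]]; rewrite /strand_ends /glabel /gdiag /= ?gen_labelE /=.
  case: s => [/pair_label ->|].
    have [->|cb] := eqVneq c b; first by rewrite surgery_labelB.
    have [->|ca] := eqVneq c a; first by rewrite surgery_labelA ab.
    apply: leq_trans (label_le okd (true, c)).
    by apply: label_other; rewrite !xpair_eqE.
  rewrite !xpair_eqE /=.
  have [->|ca] := eqVneq c a; first by move/UV_label ->; case: ifP; lia.
  have [->|cb] /= := eqVneq c b; first by move/UV_label ->; lia.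
  move/pair_label ->; apply: leq_trans (label_le okd (true, c)).
  by apply: label_other; rewrite !xpair_eqE.
case: ifP => [/orP[]/eqP ->|/negbT]; [by move/UV_label ->|move/UV_label ->|].
  by rewrite labB; lia.
by rewrite negb_or => /andP[? ?] /pair_label ->; exact: label_other.
Qed.

Lemma compose_surgery : compose d g = d'.
Proof.
congr (_, _); apply/ffunP => w; rewrite ffunE; last first.
  by apply: val_inj; exact: strand_label_surgery.
case: pickP => [w'|] /=.
  rewrite mem_strand_outer strand_ends_outer !inE => /andP[/negbTE nw].
  rewrite eq_sym nw /= => /eqP ->; rewrite -[LHS]surgery_invol //.
move/(_ (d'.1 w)); rewrite surgery_arc_neq mem_strand_outer strand_ends_outer !inE.
by rewrite surgery_invol eqxx orbT.
Qed.

(** [strand_ends] is never empty, so every strand reaches an outer node. *)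
Lemma nloops_surgery k : nloops d g k = 0.
Proof.
apply: eq_card0 => S; apply/negP => /imsetP[x]; rewrite inE => /andP[/forallP nx _] _.
have [w wx] : exists w, w \in strand_ends x.
  by rewrite /strand_ends; do ![case: ifP => _]; eexists; rewrite !inE; apply/orP; left.
by have := nx w; rewrite inE strand_ends_connect.
Qed.

End RightMultiplication.

(** * The product with a generator is again an Okada arc-diagram *)

Lemma arc_between N (d : rawdiag N) (okd : is_okada d) a c : c != a -> c != d.1 a ->
  (npos a < npos c < npos (d.1 a)) = (npos a < npos (d.1 c) < npos (d.1 a)).
Proof.
move=> ca cp; have ne (u w : node N) : u != w -> npos u != npos w.
  by rewrite (inj_eq (@npos_inj N)).
have := ne _ _ ca; have := ne _ _ cp.
have /ne : d.1 c != a by rewrite arc_eq.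
have /ne : d.1 c != d.1 a by rewrite (inj_eq (can_inj (arcK okd))).
have := arc_noncrossing okd a c; have := arc_noncrossing okd a (d.1 c).
have := arc_noncrossing okd c a; have := arc_noncrossing okd (d.1 c) a.
rewrite !arcK //; lia.
Qed.

(* A consequence of non-crossing, simpler to propagate than to derive: it gives a
   propagating arc two ends of the same parity, as half diagrams require. *)
Definition odd_arcs N (d : rawdiag N) := forall w, odd (npos w + npos (d.1 w)).

Definition id_from N (d : rawdiag N) (r : nat) :=
  forall w : node N, r <= w.2 -> d.1 w = nmir w /\ d.2 w = w.2.+1 :> nat.

Section SurgeryOkada.
Variables (N : nat) (d : rawdiag N) (a b : 'I_N).
Hypotheses (okd : is_okada d) (ab : b = a.+1 :> nat).
Let A : node N := (true, a).
Let B : node N := (true, b).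
Hypotheses (noloop : d.1 A != B) (labB : d.2 B = b.+1 :> nat).
Let d' := surgery d A B b.
Hypothesis (oddd : odd_arcs d).
Hypothesis (partnerB : (exists2 c : 'I_N, c = b.+1 :> nat & d.1 B = (true, c)) \/
  d.1 B = (false, b) /\ id_from d b.+1).

Lemma npos_AB : npos A = (npos B).+1.
Proof. by rewrite /npos /= ab; have := ltn_ord b; lia. Qed.

Lemma npos_V : npos (d.1 B) < npos B.
Proof.
have := ltn_ord b.
by case: partnerB => [[c cb ->]|[-> _]]; rewrite /npos /= ?cb; [have := ltn_ord c|]; lia.
Qed.

Lemma surgery_odd_arcs : odd_arcs d'.
Proof.
move=> w; have := oddd A; have := oddd B; have := npos_AB.
case: (surgeryP okd ab noloop labB w) => [->|->|-> _ _|-> _ _ _|_ _ _ _];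
  rewrite -?/A -?/B; try lia; by move=> *; exact: oddd.
Qed.

(** [A] and [B] are neighbours, so any other old arc has both on the same side. As it crosses
    neither of the two old arcs, $U$ and $V$ are on that side too, and it does not cross the arc
    joining them. *)
Lemma surgery_noncrossing w z :
  ~~ [&& npos w < npos z, npos z < npos (d'.1 w) & npos (d'.1 w) < npos (d'.1 z)].
Proof.
have AB := npos_AB; have VB := npos_V.
have nA := arc_between okd (a := A).
have nU := arc_between okd (a := d.1 A).
have nB := arc_between okd (a := B).
have nV := arc_between okd (a := d.1 B).
rewrite !arcK // in nU nV.
have ne (u t : node N) : u != t -> npos u != npos t by rewrite (inj_eq (@npos_inj N)).
have neN u t : u != d.1 t -> npos (d.1 u) != npos t.
  by move=> ut; apply: ne; rewrite arc_eq.
have neNN u t : u != t -> npos (d.1 u) != npos (d.1 t).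
  by move=> ut; apply: ne; rewrite (inj_eq (can_inj (arcK okd))).
have facts u : u != A -> u != B -> u != d.1 A -> u != d.1 B ->
  ~~ [&& npos (d.1 A) < npos u, npos u < npos (d.1 B) & npos (d.1 B) < npos (d.1 u)] &&
  ~~ [&& npos (d.1 B) < npos u, npos u < npos (d.1 A) & npos (d.1 A) < npos (d.1 u)] &&
  ~~ [&& npos u < npos (d.1 A), npos (d.1 A) < npos (d.1 u) & npos (d.1 u) < npos (d.1 B)] &&
  ~~ [&& npos u < npos (d.1 B), npos (d.1 B) < npos (d.1 u) & npos (d.1 u) < npos (d.1 A)].
  move=> uA uB uU uV.
  have := nA _ uA uU; have := nU _ uU uA; have := nB _ uB uV; have := nV _ uV uB.
  have := ne _ _ uA; have := ne _ _ uB; have := ne _ _ uU; have := ne _ _ uV.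
  have := neN _ _ uU; have := neN _ _ uV; have := neNN _ _ uA; have := neNN _ _ uB; lia.
case: (surgeryP okd ab noloop labB w) => [->|->|-> _ _|-> _ _ _|wA wB wU wV];
  rewrite -?/A -?/B; try lia.
- case: (surgeryP okd ab noloop labB z) => [->|->|-> _ _|-> _ _ _|zA zB zU zV];
  rewrite -?/A -?/B; try lia.
  by have := facts z zA zB zU zV; lia.
- case: (surgeryP okd ab noloop labB z) => [->|->|-> _ _|-> _ _ _|zA zB zU zV];
  rewrite -?/A -?/B; try lia.
  by have := facts z zA zB zU zV; lia.
- case: (surgeryP okd ab noloop labB z) => [->|->|-> _ _|-> _ _ _|zA zB zU zV];
  rewrite -?/A -?/B; [lia | lia | | |].
  + by have := facts w wA wB wU wV; lia.
  + by have := facts w wA wB wU wV; lia.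
  + exact: arc_noncrossing.
Qed.

(** An arc around the new arc $\{A,B\}$ has an end after [A], hence a label smaller than $b$. *)
Lemma label_after_A w : npos A < npos w -> d.2 w <= a.
Proof.
move=> Aw; apply: leq_trans (label_le okd w) _.
by move: Aw; case: w => [[] c]; rewrite /npos /=; have := ltn_ord a; have := ltn_ord c; lia.
Qed.

(** The arc joining $U$ and $V$ has the label of [A]. An old arc inside it was inside the arc at
    [A], or inside the arc at [B], whose label $b+1$ is larger still. An old arc around it was
    around the arc at [A]. *)
Lemma surgery_nested w z :
  [&& npos z < npos w, npos w < npos (d'.1 w) & npos (d'.1 w) < npos (d'.1 z)] ->
  d'.2 z < d'.2 w.
Proof.
have AB := npos_AB; have VB := npos_V.
have lA := label_after_A; have lA' u : npos A < npos (d.1 u) -> d.2 u <= a.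
  by move/lA; rewrite label_arc.
have ne (u t : node N) : u != t -> npos u != npos t by rewrite (inj_eq (@npos_inj N)).
have neN u t : u != d.1 t -> npos (d.1 u) != npos t.
  by move=> ut; apply: ne; rewrite arc_eq.
have lU : d.2 (d.1 A) = d.2 A by rewrite label_arc.
have lV : d.2 (d.1 B) = d.2 B by rewrite label_arc.
have lAa : d.2 A <= a.+1 by apply: (label_le okd).
(* Otherwise the old arc at [A] would cross the one at [B], with $U$ inside and [A] outside. *)
have UV : ~~ (npos (d.1 B) < npos (d.1 A) < npos B) && (npos (d.1 A) != npos B).
  have := @arc_between _ _ okd (d.1 B) A; have := ne _ _ noloop; rewrite arcK //.
  move=> -> /=; rewrite andbT => <-; [lia | |by apply/eqP => -[] /(congr1 val) /=; lia].
  by have [_ + _ _] := arc_A_neqs okd ab noloop labB; rewrite eq_sym.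
have facts u : u != A -> u != B -> u != d.1 A -> u != d.1 B ->
  [/\ [&& npos (d.1 A) < npos u, npos u < npos (d.1 u) & npos (d.1 u) < npos (d.1 B)] ->
        d.2 A < d.2 u,
      [&& npos (d.1 B) < npos u, npos u < npos (d.1 u) & npos (d.1 u) < npos (d.1 A)] ->
        d.2 A < d.2 u,
      [&& npos u < npos (d.1 A), npos (d.1 A) < npos (d.1 B) & npos (d.1 B) < npos (d.1 u)] ->
        d.2 u < d.2 A &
      [&& npos u < npos (d.1 B), npos (d.1 B) < npos (d.1 A) & npos (d.1 A) < npos (d.1 u)] ->
        d.2 u < d.2 A].
  move=> uA uB uU uV.
  have sV := @arc_between _ _ okd (d.1 B) u uV.
  rewrite !arcK // in sV; move/(_ uB) in sV.
  have nAu := label_nested okd (a := u) (c := A).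
  have nUu := label_nested okd (a := u) (c := d.1 A).
  have nVu := label_nested okd (a := u) (c := d.1 B).
  have nuA := label_nested okd (a := A) (c := u).
  have nuU := label_nested okd (a := d.1 A) (c := u).
  rewrite !arcK // lU in nUu nuU; rewrite !arcK // lV labB in nVu.
  have u1 := ne _ _ uA; have u2 := ne _ _ uB; have u3 := neN _ _ uU; have u4 := neN _ _ uV.
  have UA := ne _ _ (arc_neq okd A).
  rewrite -?/A -?/B in sV u1 u2 u3 u4.
  split.
  - by move: AB VB nUu; clear; lia.
  - by move: AB VB u1 u2 sV nAu nVu lAa ab; clear; lia.
  - by move: AB VB u3 u4 sV nuU; clear; lia.
  - by move: AB VB UV UA nuA; clear; lia.
case: (surgeryP okd ab noloop labB z) => [->|->|-> _ _|-> _ _ _|zA zB zU zV];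
  rewrite -?/A -?/B; try lia.
- case: (surgeryP okd ab noloop labB w) => [->|->|-> _ _|-> _ _ _|wA wB wU wV];
    rewrite -?/A -?/B; try lia.
  by have [] := facts w wA wB wU wV; lia.
- case: (surgeryP okd ab noloop labB w) => [->|->|-> _ _|-> _ _ _|wA wB wU wV];
    rewrite -?/A -?/B; try lia.
  + by have := lA (d.1 A); rewrite lU; lia.
  + by have [] := facts w wA wB wU wV; lia.
- case: (surgeryP okd ab noloop labB w) => [->|->|-> _ _|-> _ _ _|wA wB wU wV];
    rewrite -?/A -?/B; [lia | | | |].
  + have := lA' z; have : npos (d.1 z) != npos A by apply: neN.
    by lia.
  + by have [] := facts z zA zB zU zV; lia.
  + by have [] := facts z zA zB zU zV; lia.
  + exact: label_nested.
Qed.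

Lemma surgery_label_bounds w : let m := minn (nabs w) (nabs (d'.1 w)) in
  [&& 1 <= d'.2 w, d'.2 w <= m & odd (d'.2 w) == odd m].
Proof.
have [nUA _ _ nUV] := arc_A_neqs okd ab noloop labB.
(* The label of [A] obeys the conditions for $\min(|U|,|A|)$. If $V$ is plain, then $|U|\le b$ and
   the minimum is unchanged. If $V$ is the overlined node $b+2$ and $|U|>|A|=b$, the minimum becomes
   $b+2$, of the same parity; the value $|U|=b+1$, which would spoil this, is excluded by [oddd]. *)
have boundU : let m := minn (nabs (d.1 A)) (nabs (d.1 B)) in
    [&& 1 <= d.2 A, d.2 A <= m & odd (d.2 A) == odd m].
  have := label_bounds okd A; rewrite /nabs /=.
  have Ub : (d.1 A).2 = b :> nat -> d.1 A = (false, b).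
    case E : (d.1 A) => [[] u] /= ub; last by congr (_, _); apply: val_inj.
    by case/eqP: noloop; rewrite E; congr (_, _); apply: val_inj.
  case: partnerB => [[c cb ->]|[EV idd]] /=.
    have := oddd A; case: (eqVneq ((d.1 A).2 : nat) b) => [/Ub ->|].
      by rewrite /npos /=; have := ltn_ord b; lia.
    by rewrite cb; lia.
  have : (d.1 A).2 != b :> nat.
    by apply: contra nUV => /eqP/Ub ->; rewrite EV.
  have : (d.1 A).2 <= b.
    rewrite leqNgt; apply/negP => bU; have [+ _] := idd _ bU.
    by rewrite arcK // => /(congr1 (fun w : node N => val w.2)) /= aU; move: bU; rewrite -aU; lia.
  rewrite EV /=; lia.
case: (surgeryP okd ab noloop labB w) => [->|->|-> _ _|-> _ _ _|wA wB wU wV];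
  rewrite -?/A -?/B //.
- by rewrite /nabs /=; lia.
- by rewrite /nabs /=; lia.
- by rewrite /= minnC; exact: boundU.
- exact: label_bounds.
Qed.

Lemma surgery_okada : is_okada d'.
Proof.
apply/and4P; split; apply/forallP => w.
- by rewrite surgery_arc_neq ?surgery_invol ?surgery_label_arc ?eqxx.
- by apply/forallP => z; exact: surgery_noncrossing.
- exact: surgery_label_bounds.
- by apply/forallP => z; apply/implyP; exact: surgery_nested.
Qed.

Lemma surgery_id_from r : b < r -> id_from d r -> id_from d' r.
Proof.
move=> br idd w rw; have [e l] := idd w rw.
have [wA wB] : w != A /\ w != B.
  by split; apply/eqP => ew; move: rw; rewrite ew /=; lia.
have [eU eV] : w != d.1 A /\ w != d.1 B.
  rewrite -!arc_eq // e; split; apply/eqP => ew; move: rw; rewrite -[w]nmirK ew /=; lia.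
by have [-> ->] := surgery_other wA wB eU eV.
Qed.

End SurgeryOkada.

(* For the initial nodes on the left or on the right, these labels are the
   members of the sets in Chain(<D|) or Chain(|D>). *)
Definition open_label N (d : rawdiag N) (S : pred (node N)) (l : nat) :=
  [exists w, [&& S w, ~~ S (d.1 w) & d.2 w == l :> nat]].

Definition initial_nodes N (s : bool) (i : nat) : pred (node N) :=
  fun w => (w.1 == s) && (w.2 < i).

Definition cut N (s : bool) (d : rawdiag N) (i : nat) : pred nat :=
  open_label d (initial_nodes s i).

(** * Effect of a generator on the chains *)

Section SurgeryCuts.
Variables (N : nat) (d : rawdiag N) (a b : 'I_N).
Hypotheses (okd : is_okada d) (ab : b = a.+1 :> nat).
Let A : node N := (true, a).
Let B : node N := (true, b).
Hypotheses (noloop : d.1 A != B) (labB : d.2 B = b.+1 :> nat).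
Let d' := surgery d A B b.

Section Avoiding.
Variable S : pred (node N).
Hypotheses (SA : ~~ S A) (SB : ~~ S B) (SV : ~~ S (d.1 B)).

(** The only modified arc that can start in [S] is the one at $U$: its old end [A] and its new end
    $V$ are both outside, and its label is kept. *)
Lemma open_surgery : open_label d' S =1 open_label d S.
Proof.
move=> l; apply: eq_existsb => w; case: (boolP (S w)) => //= Sw.
case: (surgeryP okd ab noloop labB w) => [e|e|e _ _|e _ _ _|//];
  rewrite e in Sw *; first [by case/negP: SA | by case/negP: SB | by case/negP: SV | idtac].
by rewrite arcK // SA SV label_arc.
Qed.

Lemma open_surgeryA (S' : pred (node N)) : S' =1 (fun w => (w == A) || S w) ->
  forall l, open_label d' S' l = open_label d S l || (l == b).
Proof.
move=> SE l; rewrite -open_surgery; apply/existsP/orP => [[w]|[/existsP[w]|/eqP->]].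
- rewrite !SE; have [->|wA] := eqVneq w A.
    by rewrite surgery_labelA // => /and3P[_ _]; right; rewrite eq_sym.
  case/and3P=> Sw; rewrite negb_or => /andP[_ Sdw] lw; left.
  by apply/existsP; exists w; apply/and3P.
- case/and3P=> Sw Sdw lw; exists w; rewrite !SE Sw orbT (negbTE Sdw) lw orbF andbT.
  apply: contraNN SB => /eqP dA.
  by move: Sw; rewrite -[w](surgery_invol okd ab noloop labB) -/d' dA surgery_arcA.
- exists A; rewrite !SE eqxx surgery_arcA surgery_labelA // eqxx andbT orTb.
  by rewrite negb_or SB eq_sym (neq_AB okd).
Qed.

(** With both ends inside, the new arc no longer crosses the boundary, so the label added by
    [open_surgeryA] disappears again. *)
Lemma open_surgeryAB (S' : pred (node N)) : S' =1 (fun w => [|| w == A, w == B | S w]) ->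
  open_label d' S' =1 open_label d S.
Proof.
move=> SE l; rewrite -open_surgery; apply/existsP/existsP => -[w /and3P[Sw Sdw lw]]; exists w.
- move: Sw Sdw; rewrite !SE lw andbT.
  have [->|wA] := eqVneq w A; first by rewrite surgery_arcA eqxx orbT.
  have [->|wB] := eqVneq w B; first by rewrite surgery_arcB // eqxx.
  by rewrite /= => ->; rewrite !negb_or => /and3P[].
- rewrite !SE Sw !orbT lw !negb_or Sdw !andbT.
  have dS u : ~~ S (d'.1 u) -> d'.1 w != u.
    by apply: contraNneq => <-; rewrite surgery_invol.
  by rewrite !dS // ?surgery_arcA ?surgery_arcB.
Qed.

End Avoiding.

(** The old arc at [B] was internal. If the old arc at [A] left [S], the joined arc takes its place,
    starting at $V$ with the same label. *)
Lemma open_surgery_containing (S : pred (node N)) : S A -> S B -> S (d.1 B) ->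
  open_label d' S =1 open_label d S.
Proof.
move=> SA SB SV l; have [nUA nVA nVB nUV] := arc_A_neqs okd ab noloop labB.
apply/existsP/existsP => -[w].
- case: (surgeryP okd ab noloop labB w) => [->|->|-> _ _|-> _ _ _|wA wB wU wV];
    rewrite -?/A -?/B ?SA ?SB ?SV ?andbF //.
  + by case/and3P=> _ SU lA; exists A; rewrite SA SU lA.
  + by case/and3P=> Sw Sdw lw; exists w; apply/and3P.
- have [->|wA] := eqVneq w A; last have [->|wB] := eqVneq w B; rewrite ?SV ?andbF //.
    case/and3P=> _ SU lA; exists (d.1 B).
    by rewrite SV surgery_arcV // SU surgery_labelV.
  have [->|wU] := eqVneq w (d.1 A); first by rewrite arcK // SA andbF.
  have [->|wV] := eqVneq w (d.1 B); first by rewrite arcK // SB andbF.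
  by case/and3P=> Sw Sdw lw; exists w; have [-> ->] := surgery_other wA wB wU wV; apply/and3P.
Qed.

End SurgeryCuts.

(* The state of d = d0 G_m G_(m-1) ... G_k: an arc {k, k + 1} of label k has been
   inserted among the overlined nodes of d0, pushing the nodes k, ..., m - 1 two
   places up and the node m onto the plain node m + 1.  For k = m + 1, d is d0. *)
Record insertion N (d0 : rawdiag N) (m k : nat) (d : rawdiag N) : Prop := Insertion {
  insertion_okada : is_okada d;
  insertion_odd : odd_arcs d;
  insertion_id : id_from d m.+1;
  insertion_arc : forall a : 'I_N, a.+1 = k ->
    d.2 (true, a) = k :> nat /\
    ((exists2 c : 'I_N, c = k :> nat & d.1 (true, a) = (true, c)) \/
     d.1 (true, a) = (false, a) /\ k = m.+1);
  insertion_left : forall j, j <= m -> cut false d j =1 cut false d0 j;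
  insertion_low : forall j, j < k -> cut true d j =1 cut true d0 j;
  insertion_at : forall l, cut true d k l = cut true d0 k.-1 l || (l == k);
  insertion_high : forall j, k < j <= m.+1 -> cut true d j =1 cut true d0 (j - 2) }.

(** Before the first generator, the distinguished arc is the vertical one at $m+1$; it accounts for
    the extra label in the cut at $m+1$. *)
Lemma insertion_start N (d : rawdiag N) m : m < N ->
  is_okada d -> odd_arcs d -> id_from d m -> insertion d m m.+1 d.
Proof.
move=> mN okd oddd idd; split=> //.
- by move=> w mw; apply: idd; apply: ltnW.
- by move=> a am; have [] := idd (true, a); rewrite /= -?am; [lia | split=> //; right].
- move=> l; apply/existsP/orP => [[w]|[/existsP[w]|/eqP->]].
  + case: w => s a /and3P[/andP[/= /eqP->]]; rewrite ltnS leq_eqVlt => /orP[/eqP am|am].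
      have [|_ ->] := idd (true, a); first by rewrite /= am.
      by rewrite /= am => _; right; rewrite eq_sym.
    move=> Sd lw; left; apply/existsP; exists (true, a); apply/and3P; split=> //.
    by apply: contra Sd => /andP[e lt]; rewrite /initial_nodes e ltnS ltnW.
  + case: w => s a /and3P[/andP[/= /eqP-> am] Sd lw]; exists (true, a).
    rewrite /initial_nodes eqxx /= lw ltnS ltnW // andbT.
    apply: contra Sd => /andP[e]; rewrite ltnS leq_eqVlt => /orP[/eqP dm|lt]; last by apply/andP.
    have [] := idd (d.1 (true, a)); rewrite ?dm // arcK //.
    move=> /(congr1 (fun w : node N => val w.2)) /=.
    by rewrite dm => ea; move: am; rewrite ea ltnn.
  + exists (true, Ordinal mN); have [-> ->] := idd (true, Ordinal mN) (leqnn m).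
    by rewrite /initial_nodes /= ltnSn eqxx.
- by move=> j; lia.
Qed.

Lemma insertion_step N (d0 d : rawdiag N) m (a b : 'I_N) :
  b = a.+1 :> nat -> b <= m < N -> insertion d0 m b.+1 d ->
  let d' := compose d (raw_gen N b) in
  (forall k, nloops d (raw_gen N b) k = 0) /\ insertion d0 m b d'.
Proof.
move=> ab /andP[bm mN] [okd oddd idd arcd leftd lowd atd highd] /=.
have [labB pB] := arcd b erefl.
have noloop : d.1 (true, a) != (true, b).
  apply/eqP => e; have : d.1 (true, b) = (true, a) by rewrite -e arcK.
  by case: pB => [[c cb ->]|[-> //]] [] /(congr1 val) /=; rewrite cb ab; lia.
have partnerB : (exists2 c : 'I_N, c = b.+1 :> nat & d.1 (true, b) = (true, c)) \/
    d.1 (true, b) = (false, b) /\ id_from d b.+1.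
  by case: pB => [|[-> ->]]; [left | right].
have initE (s s' : bool) (c : 'I_N) j : initial_nodes s j (s', c) = (s' == s) && (c < j) by [].
rewrite (compose_surgery okd ab noloop labB); split.
  by move=> k; exact: (nloops_surgery okd ab noloop labB).
have cut_a : cut true d a =1 cut true d0 a by apply: lowd; rewrite ab; lia.
have out_a : [/\ ~~ initial_nodes true a (true, a), ~~ initial_nodes true a (true, b) &
               ~~ initial_nodes true a (d.1 (true, b))].
  by case: pB => [[c cb ->]|[-> _]]; rewrite !initE ?cb ab /=; split; lia.
split.
- exact: surgery_okada.
- exact: surgery_odd_arcs.
- exact: surgery_id_from.
- move=> a' a'b; have -> : a' = a by apply: val_inj => /=; lia.
  by rewrite surgery_labelA // surgery_arcA; split=> //; left; exists b.
- move=> j jm; apply: ftrans (leftd j jm); apply: open_surgery => //.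
  by case: pB => [[c _ ->] //|[-> [bm']]]; rewrite initE; lia.
- move=> j jb; apply: ftrans (lowd j _); last by lia.
  by apply: open_surgery => //; rewrite ?initE //= -?leqNgt; [lia|lia|
    case: pB => [[c cb ->]|[-> _]]; rewrite initE ?cb; lia].
- move=> l; case: out_a => oA oB oV; rewrite ab /= -cut_a -ab.
  apply: open_surgeryA => //; case=> s c; rewrite /initial_nodes /= xpair_eqE -val_eqE /=.
  by case: s => //=; rewrite ab ltnS leq_eqVlt.
- move=> j /andP[bj jm]; have [->|bj2] := eqVneq j b.+1.
    have -> : b.+1 - 2 = a by lia.
    case: out_a => oA oB oV; apply: ftrans cut_a; apply: open_surgeryAB => //.
    by case=> s c; rewrite /initial_nodes !xpair_eqE -!val_eqE /= ab; case: s => //=; lia.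
  apply: ftrans (highd j _); last by lia.
  (* Such a $j$ forces $b<m$, so the partner of [B] is the overlined node $b+2$, which lies in the
     segment together with [A] and [B]. *)
  case: pB => [[c cb eV]|[_ [bm']]]; last by lia.
  by apply: open_surgery_containing; rewrite ?eV ?initE //=; lia.
Qed.

(** * Fomin's growth diagram *)

Section GrowthDiagram.
Variables (N : nat) (s : 'S_N).

(** By [lambda_rank] this is the rank of $\lambda(i,j)$; it also serves as the level of the cut to
    be compared with $\lambda(i,j)$. *)
Definition grid_rank (i j : nat) : nat := #|[set k : 'I_N | (k < i) && (s k < j)]|.

Lemma grid_rankS_row (k : 'I_N) j : grid_rank k.+1 j = grid_rank k j + (s k < j).
Proof.
rewrite /grid_rank (cardsD1 k) inE ltnSn /= addnC; congr (_ + _).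
apply: eq_card => u; rewrite !inE -val_eqE ltnS /=.
by have := ltngtP u k; case: ltngtP.
Qed.

Lemma grid_rankS_col i (c : 'I_N) : grid_rank i c.+1 = grid_rank i c + (s^-1%g c < i).
Proof.
rewrite /grid_rank (cardsD1 (s^-1%g c)) inE permKV ltnSn andbT addnC; congr (_ + _).
apply: eq_card => u; rewrite !inE ltnS -(inj_eq (@perm_inj _ s)) permKV -val_eqE /=.
by rewrite andbCA -ltn_neqAle.
Qed.

Lemma grid_rank_full j : j <= N -> grid_rank N j = j.
Proof.
elim: j => [|j IHj] jN; first by apply: eq_card0 => u; rewrite !inE andbF.
by rewrite (grid_rankS_col N (Ordinal jN)) /= IHj ?ltn_ord ?addn1 // ltnW.
Qed.

Lemma grid_rank_full_col i : i <= N -> grid_rank i N = i.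
Proof.
elim: i => [|i IHi] iN; first by apply: eq_card0 => u; rewrite !inE.
by rewrite (grid_rankS_row (Ordinal iN)) /= IHi ?ltn_ord ?addn1 // ltnW.
Qed.

Lemma markedE (k c : 'I_N) : marked s k c = (s k == c).
Proof.
apply/existsP/eqP => [[u /andP[/eqP/val_inj -> /eqP/val_inj //]]|<-].
by exists k; rewrite !eqxx.
Qed.

Lemma lambda0r i : lambda s i 0 = fib0. Proof. by case: i. Qed.

Lemma lambdaSS i j : lambda s i.+1 j.+1 =
  growth (marked s i j) (lambda s i j) (lambda s i j.+1) (lambda s i.+1 j).
Proof. by []. Qed.

Lemma lambda_row (k : 'I_N) j : j <= s k -> lambda s k.+1 j = lambda s k j.
Proof.
elim: j => [|j IHj] jk; first by rewrite !lambda0r.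
have jN : j < N by exact: ltn_trans (ltn_ord (s k)).
rewrite lambdaSS IHj ?(ltnW jk) // (markedE k (Ordinal jN)) /growth -val_eqE /= (gtn_eqF jk).
by case: eqP => [->//|_]; rewrite eqxx.
Qed.

Lemma lambda_col i (c : 'I_N) : i <= s^-1%g c -> lambda s i c.+1 = lambda s i c.
Proof.
elim: i => [//|i IHi] ic; have iN : i < N by exact: ltn_trans (ltn_ord (s^-1%g c)).
rewrite lambdaSS IHi ?(ltnW ic) // (markedE (Ordinal iN) c) /growth eqxx.
case: eqP => // e; move: ic; rewrite -e permK ltnn //.
Qed.

Lemma lambda_marked (k : 'I_N) : lambda s k.+1 (s k).+1 = fib_add (lambda s k (s k)).
Proof. by rewrite lambdaSS markedE eqxx. Qed.

(** If the point of the row or of the column comes later, [lambda_row] or [lambda_col] reduces to an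
    earlier square. If both came before, $x$ and $y$ have larger rank than $t$ by induction, so only
    the last growth rule can apply. *)
Lemma lambda_rank i j : i <= N -> j <= N -> (val (lambda s i j)).1 = grid_rank i j.
Proof.
elim: i j => [|i IHi] j; first by move=> *; rewrite /grid_rank eq_card0 // => u; rewrite !inE.
move=> iN; have IH := IHi _ (ltnW iN); pose k := Ordinal iN.
elim: j => [|j IHj] jN.
  by rewrite lambda0r /grid_rank eq_card0 // => u; rewrite !inE andbF.
pose c := Ordinal jN.
have rk1 : grid_rank i.+1 j = grid_rank i j + (s k < j) := grid_rankS_row k j.
have rk2 : grid_rank i.+1 j.+1 = grid_rank i j.+1 + (s k < j.+1) := grid_rankS_row k j.+1.
have rk3 : grid_rank i j.+1 = grid_rank i j + (s^-1%g c < i) := grid_rankS_col i c.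
have [sk|sk|/val_inj sk] := ltngtP (s k) c.
- have [sc|sc] := leqP i.+1 (s^-1%g c).
    rewrite (@lambda_col i.+1 c) // IHj ?(ltnW jN) // rk2 rk3 rk1.
    by rewrite ltnS sk (ltnW sk) (ltnNge _ i) (ltnW sc) addn0.
  have sc' : s^-1%g c < i.
    rewrite ltn_neqAle -ltnS sc andbT; apply/eqP => e.
    have : s^-1%g c = k by apply: val_inj.
    by move=> e'; move: sk; rewrite -e' permKV ltnn.
  rewrite lambdaSS (markedE k c) -val_eqE /= (ltn_eqF sk) /growth.
  case: eqP => [e|_].
    by have := congr1 (fun t => (val t).1) e; rewrite !IH ?(ltnW jN) //; lia.
  case: eqP => [e|_].
    have := congr1 (fun t => (val t).1) e; rewrite IHj ?IH ?(ltnW jN) // rk1.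
    by rewrite sk; lia.
  rewrite /= IH ?(ltnW jN) // rk2 rk3 sc' (ltn_trans sk) //.
  by lia.
- rewrite (@lambda_row k) // IH // rk2 ltnS leqNgt sk addn0 //.
- rewrite -[j]/(c : nat) -sk (lambda_marked k) /= IH; last by rewrite sk ltnW.
  have -> : grid_rank i.+1 (s k).+1 = grid_rank i (s k).+1 + 1.
    by rewrite (grid_rankS_row k) ltnSn.
  by rewrite (grid_rankS_col i (s k)) permK ltnn addn0 addn1.
Qed.

Lemma lambda_raise (k c : 'I_N) : s k < c -> s^-1%g c < k ->
  lambda s k.+1 c.+1 = fib_raise (lambda s k c).
Proof.
move=> sk sc; have [kN cN] := (ltn_ord k, ltn_ord c).
have nm : marked s k c = false by rewrite markedE -val_eqE /= (ltn_eqF sk).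
rewrite lambdaSS nm /growth.
case: eqP => [/(congr1 (fun t => (val t).1))|_].
  by rewrite !lambda_rank ?(ltnW kN) ?(ltnW cN) // grid_rankS_col sc; lia.
case: eqP => [/(congr1 (fun t => (val t).1))|//].
rewrite !lambda_rank ?(ltnW kN) ?(ltnW cN) // grid_rankS_row sk; lia.
Qed.

End GrowthDiagram.

Lemma lambda_inv N (s : 'S_N) i j : lambda s^-1 i j = lambda s j i.
Proof.
elim: i j => [|i IHi] j; first by rewrite lambda0r.
elim: j => [|j IHj]; first by rewrite lambda0r.
rewrite !lambdaSS !IHi IHj /growth.
have -> : marked s^-1 i j = marked s j i.
  apply/existsP/existsP => -[u /andP[ui uj]].
    by exists (s^-1%g u); rewrite permKV ui uj.
  by exists (s u); rewrite permK ui uj.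
(* The order of the two tests matters only if both succeed, and then $x=y=t$. *)
by do 2![case: eqP] => // -> ->.
Qed.

(** * A half diagram is determined by its chain *)

Definition half_cut N (H : rawhalf N) (i l : nat) : bool :=
  [exists a : 'I_N, [&& a < i, (H.1 a == a) || (i <= H.1 a) & H.2 a == l :> nat]].

Section HalfFacts.
Variables (N : nat) (H : rawhalf N).
Hypothesis okH : is_half H.

Lemma halfK : involutive H.1.
Proof. by move=> v; case/and5P: okH => /forallP/(_ v)/andP[/eqP]. Qed.

Lemma half_label_arc v : H.2 (H.1 v) = H.2 v.
Proof. by case/and5P: okH => /forallP/(_ v)/andP[_ /eqP]. Qed.

Lemma half_noncrossing (a c : 'I_N) : ~~ [&& a < c, c < H.1 a & H.1 a < H.1 c].
Proof. by case/and5P: okH => _ /forallP/(_ a)/forallP/(_ c). Qed.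

Lemma half_outside (a c : 'I_N) : H.1 c = c -> ~~ (a < c < H.1 a).
Proof.
by move=> e; case/and5P: okH => _ _ /forallP/(_ a)/forallP/(_ c); rewrite e eqxx.
Qed.

Lemma half_label_bounds (a : 'I_N) : 0 < H.2 a <= a.+1.
Proof. by case/and5P: okH => _ _ _ /forallP/(_ a) /=; lia. Qed.

Lemma half_nested (a c : 'I_N) : [&& c < a, a < H.1 a & H.1 a < H.1 c] -> H.2 c < H.2 a.
Proof. by case/and5P: okH => _ _ _ _ /andP[/forallP/(_ a)/forallP/(_ c)/implyP]. Qed.

Lemma half_right (a c : 'I_N) : H.1 c = c -> c < a -> c < H.1 a -> H.2 c < H.2 a.
Proof.
move=> e ca cp; case/and5P: okH => _ _ _ _ /andP[_ /forallP/(_ a)/forallP/(_ c)/implyP]; apply.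
by rewrite e eqxx; lia.
Qed.

Lemma half_val_eq (a c : 'I_N) : (H.1 a == c :> nat) = (a == H.1 c :> nat).
Proof. by rewrite !val_eqE (can2_eq halfK halfK). Qed.

(** What is still open at [i] is either a half arc to the left of the arc at [i] or a full arc
    around it; both label conditions point the same way. *)
Lemma half_open_lt (a i : 'I_N) :
  a < i -> (H.1 a == a) || (i <= H.1 a) -> i <= H.1 i -> H.2 a < H.2 i.
Proof.
move=> ai /orP[/eqP e|ia] ii; first by apply: half_right => //; apply: leq_trans ii.
have ne : H.1 a != i :> nat by rewrite half_val_eq; lia.
have ni : H.1 i != i.
  by apply/eqP => e; have := half_outside a e; lia.
have ne2 : H.1 i != H.1 a :> nat by rewrite half_val_eq halfK; lia.
have := half_noncrossing a i; move: ni; rewrite -val_eqE /= => ni nc.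
by apply: half_nested; lia.
Qed.

(** Freshness of the label, in the second conjunct, lets the chain distinguish an opening node from
    a closing one. *)
Lemma half_cutS_opening (i : 'I_N) : i <= H.1 i ->
  (forall l, half_cut H i.+1 l = half_cut H i l || (l == H.2 i)) /\
  half_cut H i (H.2 i) = false.
Proof.
move=> ii; split=> [l|].
  apply/existsP/orP => [[a /and3P[]]|[/existsP[a /and3P[ai oa la]]|/eqP->]].
  - rewrite ltnS leq_eqVlt => /orP[/eqP/val_inj -> _ /eqP <-|ai oa la]; first by right.
    left; apply/existsP; exists a; rewrite ai la andbT /=.
    by case/orP: oa => [->|/ltnW->] //; rewrite orbT.
  - exists a; rewrite ltnS (ltnW ai) la andbT /=; case/orP: oa => [->//|].
    rewrite leq_eqVlt => /orP[|->]; last by rewrite orbT.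
    by rewrite eq_sym half_val_eq; lia.
  - exists i; rewrite ltnSn eqxx andbT -val_eqE /=.
    by move: ii; rewrite leq_eqVlt eq_sym.
apply/negbTE/negP => /existsP[a /and3P[ai oa /eqP la]].
by have := half_open_lt ai oa ii; rewrite la ltnn.
Qed.

Lemma half_cutS_closing (i : 'I_N) : H.1 i < i ->
  (forall l, half_cut H i l = half_cut H i.+1 l || (l == H.2 i)) /\
  half_cut H i.+1 (H.2 i) = false.
Proof.
move=> ii.
have openS (a : 'I_N) : a < i.+1 -> (H.1 a == a) || (i < H.1 a) -> a < i.
  rewrite ltnS leq_eqVlt => /orP[/eqP/val_inj ->|//].
  by rewrite -val_eqE /=; lia.
split=> [l|].
  apply/existsP/orP => [[a /and3P[ai oa la]]|[/existsP[a /and3P[ai oa la]]|/eqP->]].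
  - case/orP: oa => [e|].
      by left; apply/existsP; exists a; rewrite ltnS (ltnW ai) e la.
    rewrite leq_eqVlt => /orP[/eqP/val_inj e|ia]; last first.
      by left; apply/existsP; exists a; rewrite ltnS (ltnW ai) ia orbT la.
    by right; rewrite e half_label_arc eq_sym.
  - exists a; rewrite (openS a) //= la andbT.
    by case/orP: oa => [->//|/ltnW ->]; rewrite orbT.
  - by exists (H.1 i); rewrite ii halfK leqnn orbT half_label_arc eqxx.
apply/negbTE/negP => /existsP[a /and3P[ai oa /eqP la]].
have {}ai := openS a ai oa.
have [ab|ba|/val_inj ab] := ltngtP a (H.1 i).
- have := @half_open_lt a (H.1 i) ab; rewrite halfK half_label_arc la ltnn => contra.
  suff : false by []; apply: contra; last exact: ltnW.
  by case/orP: oa => [->//|h]; rewrite (leq_trans _ (ltnW h)) ?orbT // ltnW.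
- case/orP: oa => [/eqP e|ia].
    by have := half_outside (H.1 i) e; rewrite halfK ba ai.
  by have := half_noncrossing (H.1 i) a; rewrite halfK ba ai ia.
- by move: oa; rewrite ab halfK -val_eqE /=; lia.
Qed.

(* So a right end i is joined to the last node before i with the same label. *)
Lemma half_label_between (a i : 'I_N) : H.1 i < a < i -> H.2 a != H.2 i.
Proof.
case/andP=> ba ai.
have na : H.1 a != a :> nat.
  by apply/eqP => /val_inj e; have := half_outside (H.1 i) e; rewrite halfK ba ai.
have n1 := half_noncrossing (H.1 i) a; have n2 := half_noncrossing (H.1 a) (H.1 i).
have n3 : H.1 a != i :> nat by rewrite half_val_eq; lia.
have n4 : H.1 a != H.1 i :> nat by rewrite half_val_eq halfK; lia.
have h1 := @half_nested a (H.1 i); have h2 := @half_nested (H.1 a) (H.1 i).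
rewrite !halfK !half_label_arc in n1 n2 h1 h2.
apply/eqP => e; rewrite e ltnn in h1 h2.
have [aa|aa] := leqP a (H.1 a); suff : false by [].
- by apply: h1; lia.
- by apply: h2; lia.
Qed.

Lemma mem_plab_restrict i (iN : i <= N) l : (l \in plab (restrict iN H)) = half_cut H i l.
Proof.
rewrite mem_filter mem_iota.
have E (a : 'I_i) : (((restrict iN H).1 a == a) && ((restrict iN H).2 a == l :> nat)) =
    [&& (widen_ord iN a < i), (H.1 (widen_ord iN a) == widen_ord iN a) ||
        (i <= H.1 (widen_ord iN a)) & H.2 (widen_ord iN a) == l :> nat].
  rewrite !ffunE -!val_eqE val_insubd /= ltn_ord /= inordK; last first.
    by have := half_label_bounds (widen_ord iN a); have /= := ltn_ord a; lia.
  by congr (_ && _); case: ltnP => _; rewrite ?orbF ?eqxx ?orbT.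
apply/andP/existsP => [[/existsP[a]]|[a ha]].
  by rewrite E => ha _; exists (widen_ord iN a).
have lt : a < i by case/and3P: ha.
have aE : a = widen_ord iN (Ordinal lt) by apply: val_inj.
split; first by apply/existsP; exists (Ordinal lt); rewrite E -aE.
by have := half_label_bounds a; case/and3P: ha => _ _ /eqP ->; lia.
Qed.

Lemma mem_plab l : (l \in plab H) = half_cut H N l.
Proof.
rewrite mem_filter mem_iota; apply/andP/existsP => [[/existsP[a /andP[e la]] _]|[a]].
  by exists a; rewrite ltn_ord e la.
case/and3P=> aN; rewrite leqNgt ltn_ord orbF => e la; split.
  by apply/existsP; exists a; rewrite e la.
by have := half_label_bounds a; rewrite (eqP la); lia.
Qed.

End HalfFacts.

(** The label that appears or disappears between consecutive cuts gives the direction and the label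
    of each node; the arcs are then recovered from their right ends. *)
Lemma half_inj N (H H' : rawhalf N) : is_half H -> is_half H' ->
  (forall i, i <= N -> half_cut H i =1 half_cut H' i) -> H = H'.
Proof.
move=> okH okH' eqc.
have eqi (i : 'I_N) := eqc i (ltnW (ltn_ord i)).
have eqSi (i : 'I_N) := eqc i.+1 (ltn_ord i).
have dir (i : 'I_N) : (i <= H.1 i) = (i <= H'.1 i).
  have [o|c] := leqP i (H.1 i); have [o'|c'] := leqP i (H'.1 i) => //.
    have [h1 h2] := half_cutS_opening okH o; have [h1' _] := half_cutS_closing okH' c'.
    by have := h1' (H.2 i); rewrite -eqi -eqSi h1 h2 eqxx.
  have [h1 _] := half_cutS_closing okH c; have [h1' h2'] := half_cutS_opening okH' o'.
  by have := h1 (H'.2 i); rewrite eqi eqSi h1' h2' eqxx.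
have lab i : H.2 i = H'.2 i.
  apply/val_inj/eqP; rewrite /=; have [o|c] := leqP i (H.1 i).
    have [h1 h2] := half_cutS_opening okH o; move: (o); rewrite dir => o'.
    have [h1' _] := half_cutS_opening okH' o'.
    by have := h1' (H.2 i); rewrite -eqi -eqSi h1 h2 eqxx.
  have [h1 h2] := half_cutS_closing okH c; move: (c); rewrite ltnNge dir -ltnNge => c'.
  have [h1' _] := half_cutS_closing okH' c'.
  by have := h1' (H.2 i); rewrite -eqi -eqSi h1 h2 eqxx.
(* If the two left ends differed, the later one would lie strictly inside the arc of the other
   diagram and carry its label. *)
have closing (i : 'I_N) : H.1 i < i -> H.1 i = H'.1 i.
  move=> c; move: (c); rewrite ltnNge dir -ltnNge => c'; apply: val_inj => /=.
  have [lt|lt|//] := ltngtP (H.1 i) (H'.1 i).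
    have := @half_label_between _ _ okH (H'.1 i) i; rewrite lt c' => /(_ isT).
    by rewrite lab half_label_arc // lab eqxx.
  have := @half_label_between _ _ okH' (H.1 i) i; rewrite lt c => /(_ isT).
  by rewrite -lab half_label_arc // lab eqxx.
have arc i : H.1 i = H'.1 i.
  have [lt|lt|e] := ltngtP (H.1 i) i; first exact: closing.
    have := closing (H.1 i); rewrite halfK // => /(_ lt) e.
    by rewrite [in RHS]e halfK.
  have [lt|lt|e'] := ltngtP (H'.1 i) i.
  - by move: lt; rewrite ltnNge -dir e leqnn.
  - have eK := halfK okH' i.
    have := closing (H'.1 i); rewrite eK => c.
    have : H.1 (H'.1 i) < H'.1 i by rewrite ltnNge dir eK -ltnNge.
    move/[dup] => h /c ce; move: e; rewrite -{1}ce halfK //.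
    by move/eqP => e; move: lt; rewrite (eqP e) ltnn.
  - by apply: val_inj; rewrite /= e e'.
by case: H H' lab arc {okH okH' eqc eqi eqSi dir closing} => [p h] [p' h'] /= /ffunP -> /ffunP ->.
Qed.

(** * From a diagram to its two halves and back *)

(** An arc leaving one side cannot end above [r], where nodes meet only their mirror images; so it
    also leaves the other side. *)
Lemma cut_balanced N (d : rawdiag N) r : is_okada d -> id_from d r ->
  cut false d r =1 cut true d r.
Proof.
move=> okd idd l; apply/existsP/existsP => -[[s a] /and3P[/andP[/= /eqP -> ar] Sd lw]];
  move E: (d.1 _) (Sd) => [s' c]; rewrite negb_and -leqNgt /= => /orP Sc.
- have cr : c < r.
    rewrite ltnNge; apply/negP => rc; have [] := idd (s', c) rc; rewrite -E arcK // => + _.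
    by rewrite E => /(congr1 (fun w : node N => val w.2)) /= e; move: ar; rewrite e ltnNge rc.
  exists (s', c); rewrite -E label_arc // arcK // lw E /initial_nodes /= cr !andbT.
  by case: Sc => [|]; [case: s' {E} | rewrite leqNgt cr].
- have cr : c < r.
    rewrite ltnNge; apply/negP => rc; have [] := idd (s', c) rc; rewrite -E arcK // => + _.
    by rewrite E => /(congr1 (fun w : node N => val w.2)) /= e; move: ar; rewrite e ltnNge rc.
  exists (s', c); rewrite -E label_arc // arcK // lw E /initial_nodes /= cr !andbT.
  by case: Sc => [|]; [case: s' {E} | rewrite leqNgt cr].
Qed.

Section LeftHalf.
Variables (N : nat) (d : rawdiag N).
Hypothesis okd : is_okada d.

Variant left_half_spec (a : 'I_N) : node N -> 'I_N -> Prop :=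
  | LeftFull c of d.1 (false, a) = (false, c) & c != a : left_half_spec a (false, c) c
  | LeftHalf c of d.1 (false, a) = (true, c) : left_half_spec a (true, c) a.

Lemma left_halfP a : left_half_spec a (d.1 (false, a)) ((left_half d).1 a).
Proof.
rewrite ffunE; case E : (d.1 (false, a)) => [[] c] /=; first exact: LeftHalf.
by apply: LeftFull => //; have := arc_neq okd (false, a); rewrite E xpair_eqE.
Qed.

Lemma left_half_arc a b :
  d.1 (false, a) = (false, b) -> (left_half d).1 a = b.
Proof. by move=> e; rewrite ffunE e. Qed.

Lemma is_half_left_half : odd_arcs d -> is_half (left_half d).
Proof.
move=> oddd; have l2 a : (left_half d).2 a = d.2 (false, a) by rewrite ffunE.
apply/and5P; split; last (apply/andP; split); apply/forallP => a.
- rewrite !l2; case: (left_halfP a) => [c E _|c E]; last by rewrite ffunE E /= !eqxx.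
  by rewrite -E label_arc // (left_half_arc (b := a)) ?eqxx // -E arcK.
- apply/forallP => c; have := arc_noncrossing okd (false, a) (false, c).
  have := arc_noncrossing okd (false, c) (false, a).
  case: (left_halfP a) => [u E _|u E]; case: (left_halfP c) => [v E' _|v E'];
  rewrite ?E ?E' /npos /=;
  by have := ltn_ord u; have := ltn_ord v; have := ltn_ord a; have := ltn_ord c; lia.
- apply/forallP => c; apply/implyP.
  case: (left_halfP c) => [v E' /negbTE -> //|v E' _].
  have := arc_noncrossing okd (false, a) (false, c).
  case: (left_halfP a) => [u E _|u E]; rewrite ?E ?E' /npos /=;
  by have := ltn_ord u; have := ltn_ord v; have := ltn_ord a; have := ltn_ord c; lia.
- have := label_bounds okd (false, a); rewrite l2 /nabs /=.
  have := oddd (false, a); case: (left_halfP a) => [u E _|u E] /=; rewrite ?minnSS //.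
  by rewrite minnn /npos /=; have := ltn_ord u; lia.
- apply/forallP => c; apply/implyP; have := label_nested okd (a := (false, a)) (c := (false, c)).
  rewrite !l2; case: (left_halfP a) => [u E _|u E]; case: (left_halfP c) => [v E' _|v E'];
  rewrite ?E ?E' /npos /=;
  by have := ltn_ord u; have := ltn_ord v; have := ltn_ord a; have := ltn_ord c; lia.
- apply/forallP => c; apply/implyP; rewrite !l2.
  case: (left_halfP c) => [v E' /negbTE -> //|v E' /andP[_]].
  (* [a] may be the right end of its full arc, so nesting is tested from both ends. *)
  have := label_nested okd (a := (false, a)) (c := (false, c)).
  have := label_nested okd (a := d.1 (false, a)) (c := (false, c)).
  have := arc_noncrossing okd (false, c) (false, a).
  have := arc_noncrossing okd (d.1 (false, a)) (false, c).
  have := arc_noncrossing okd (false, c) (d.1 (false, a)).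
  rewrite !arcK // label_arc //.
  have : ((d.1 (false, a) : node N) != d.1 (false, c)) = (a != c).
    by rewrite (inj_eq (can_inj (arcK okd))).
  rewrite -(inj_eq (@npos_inj N)) -!val_eqE.
  case: (left_halfP a) => [u E|u E]; rewrite ?E ?E' -?val_eqE /npos /=;
  have := ltn_ord u; have := ltn_ord v; have := ltn_ord a; have := ltn_ord c; try lia.
Qed.

Lemma half_cut_left_half i : half_cut (left_half d) i =1 cut false d i.
Proof.
move=> l; apply/existsP/existsP => [[a]|[[s a]]].
  rewrite !ffunE => /and3P[ai oa la]; exists (false, a).
  rewrite /initial_nodes /= ai la andbT /= negb_and -leqNgt.
  move: oa; have := arc_neq okd (false, a); case: (d.1 _) => [[] c] //=.
  by rewrite xpair_eqE /= => /negbTE ->.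
case/and3P=> /andP[/= /eqP -> ai] oa la; exists a; rewrite ai !ffunE la andbT /=.
move: oa; rewrite /initial_nodes; case: (d.1 _) => [[] c] /=; rewrite ?eqxx //.
by rewrite -leqNgt => ->; rewrite orbT.
Qed.

(** Propagating arcs are pairwise nested, so their labels are distinct. *)
Lemma arc_eq_labels a c : (d.1 (false, a)).1 -> (d.1 (false, c)).1 ->
  d.2 (false, a) = d.2 (false, c) -> a = c.
Proof.
wlog ac : a c / a <= c.
  by move=> th ha hc e; have [/th|/ltnW/th h] := leqP a c; [exact | rewrite h].
move=> ha hc e; apply/eqP; rewrite -val_eqE; apply/eqP; move: ac.
rewrite leq_eqVlt => /orP[/eqP //|ac].
have := label_nested okd (a := (false, c)) (c := (false, a)).
have := arc_noncrossing okd (false, a) (false, c).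
have : npos (d.1 (false, a)) != npos (d.1 (false, c)).
  rewrite (inj_eq (@npos_inj N)) (inj_eq (can_inj (arcK okd))) xpair_eqE -val_eqE /=; lia.
move: ha hc; case: (d.1 (false, a)) => [[] u] //; case: (d.1 (false, c)) => [[] v] // _ _.
rewrite e /npos /=; have := ltn_ord u; have := ltn_ord v.
by have := ltn_ord a; have := ltn_ord c; lia.
Qed.

End LeftHalf.

Lemma cut_mirror N (D : okada N) i : cut false (mirror D) i =1 cut true D i.
Proof.
move=> l; apply/existsP/existsP => -[w hw]; exists (nmir w); move: hw;
  rewrite /initial_nodes ?ffunE ?nmirK /=;
  by case: ((okada_val D).1 _) => [[] c]; case: w => [[] u].
Qed.

Lemma mirrorK N : involutive (@mirror N).
Proof.
move=> D; apply: val_inj; rewrite [RHS]surjective_pairing; congr (_, _); apply/ffunP => w.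
  by rewrite !ffunE !nmirK.
by rewrite !ffunE nmirK.
Qed.

Lemma odd_arcs_mirror N (D : okada N) : odd_arcs D -> odd_arcs (mirror D).
Proof.
move=> oddD w; have := oddD (nmir w); rewrite /= ffunE.
rewrite -[in npos w](nmirK w) !npos_mir.
by have := npos_lt (nmir w); have := npos_lt ((okada_val D).1 (nmir w)); lia.
Qed.

Lemma plab_sorted N (H : rawhalf N) : sorted ltn (plab H).
Proof. apply: sorted_filter; [exact: ltn_trans | exact: iota_ltn_sorted]. Qed.

(** Full arcs are visible in the left half. A propagating arc is recovered by matching its two half
    arcs through their common label, which no other half arc has. *)
Lemma left_arcs_eq N (D D' : okada N) : left_half D = left_half D' ->
  right_half D = right_half D' -> forall a, (val D).1 (false, a) = (val D').1 (false, a).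
Proof.
move=> eL eR a; have [okD okD'] := (okada_valP D, okada_valP D').
have [okM okM'] := (okada_valP (mirror D), okada_valP (mirror D')).
have labL c : (val D).2 (false, c) = (val D').2 (false, c).
  by have := congr1 (fun H : rawhalf N => H.2 c) eL; rewrite !ffunE.
have labR c : (val D).2 (true, c) = (val D').2 (true, c).
  by have := congr1 (fun H : rawhalf N => H.2 c) eR; rewrite !ffunE.
have := congr1 (fun H : rawhalf N => H.1 a) eL.
case: (left_halfP okD a) => [c E ca|c E]; case: (left_halfP okD' a) => [c' E' ca'|c' E'].
- by move->.
- by move=> e; rewrite e eqxx in ca.
- by move=> e; rewrite e eqxx in ca'.
move=> _; congr (_, _).
have rE : (val D).1 (true, c) = (false, a) by rewrite -E arcK.
have rE' : (val D').1 (true, c') = (false, a) by rewrite -E' arcK.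
have mE : (val (mirror D)).1 (false, c) = (true, a) by rewrite ffunE /= rE.
have mE' : (val (mirror D')).1 (false, c') = (true, a) by rewrite ffunE /= rE'.
apply: (arc_eq_labels okM); first by rewrite mE.
  (* Since the right halves agree, [c'] is propagating in [D] as well. *)
  have := congr1 (fun H : rawhalf N => H.1 c') eR.
  have /eqP h : (left_half (mirror D')).1 c' == c' by rewrite ffunE mE'.
  rewrite /right_half h; case: (left_halfP okM c') => [u _ /negP ne e|//].
  by case: ne; apply/eqP.
rewrite !ffunE /= (labR c'); have := label_arc okD (false, a); rewrite E => ->.
by have := label_arc okD' (false, a); rewrite E' labL => ->.
Qed.

Lemma okada_join_inj N (D D' : okada N) :
  left_half D = left_half D' -> right_half D = right_half D' -> D = D'.
Proof.
move=> eL eR; apply: val_inj; rewrite [LHS]surjective_pairing [RHS]surjective_pairing.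
congr (_, _); apply/ffunP => -[[] a].
- have := @left_arcs_eq _ (mirror D) (mirror D') eR; rewrite /right_half !mirrorK => /(_ eL a).
  by rewrite !ffunE => /(can_inj (@nmirK N)).
- exact: left_arcs_eq.
- by have := congr1 (fun H : rawhalf N => H.2 a) eR; rewrite !ffunE.
- by have := congr1 (fun H : rawhalf N => H.2 a) eL; rewrite !ffunE.
Qed.

Lemma is_join_halves N (D : okada N) (L R : halfdiag N) :
  left_half D = L -> right_half D = R -> is_join L R D.
Proof.
move=> eL eR; split; last first.
  by split=> // D' [eL' eR']; apply: okada_join_inj; rewrite ?eL ?eR ?eL' ?eR'.
apply: (irr_sorted_eq ltn_trans ltnn) (plab_sorted _) (plab_sorted _) _ => l.
rewrite !mem_plab ?half_valP // -eL -eR !half_cut_left_half ?okada_valP // cut_mirror.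
by apply: cut_balanced; [exact: okada_valP | move=> w; rewrite leqNgt ltn_ord].
Qed.

Lemma has_chain_unique N (H : halfdiag N) c : has_chain H c -> unique (fun H' => has_chain H' c) H.
Proof.
move=> cH; split=> // H' cH'; apply: val_inj; apply: half_inj; try exact: half_valP.
move=> i iN l; rewrite -!(mem_plab_restrict (half_valP _) iN).
by have := cH i iN; rewrite -cH' => -[->].
Qed.

Lemma has_chain_half_cut N (H : halfdiag N) (c : nat -> fib) :
  (forall i, i <= N -> (val (c i)).1 = i /\ half_cut H i =1 [in (val (c i)).2]) ->
  has_chain H c.
Proof.
move=> hc i iN; have [ri ci] := hc i iN; rewrite [RHS]surjective_pairing ri; congr (_, _).
apply: (irr_sorted_eq ltn_trans ltnn) (plab_sorted _) _ _.
  by case/and4P: (fib_valP (c i)).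
by move=> l; rewrite (mem_plab_restrict (half_valP H)) ci.
Qed.

(** * The diagram of a permutation, factor by factor *)

(** The values below [c] are split into those placed after [c], counted by the code, and those
    placed before. Hence the factor stops at the $k$ for which $k-1$ is this rank. *)
Lemma inv_code_rank N (s : 'S_N) (c : 'I_N) :
  inv_code s c + grid_rank s (s^-1%g c) c = c.
Proof.
rewrite -[RHS](@grid_rank_full _ s) 1?ltnW // /grid_rank.
rewrite -[RHS](cardsID [set k : 'I_N | k < s^-1%g c]) addnC; congr (_ + _).
  by apply: eq_card => k; rewrite !inE ltn_ord andbC.
rewrite /inv_code -(card_preimset _ (@perm_inj _ s)); apply: eq_card => k.
rewrite !inE permK ltn_ord /= andbC -leqNgt [_ <= k in RHS]leq_eqVlt.
by case: eqP => [/val_inj <-|//]; rewrite permKV !ltnn ?andbF.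
Qed.

(* d is the image of the first m factors of E_sigma; the right chain of d is the
   m-th column of the growth diagram without its repetitions. *)
Record word_diag N (s : 'S_N) (m : nat) (d : rawdiag N) : Prop := WordDiag {
  word_okada : is_okada d;
  word_odd : odd_arcs d;
  word_id : id_from d m;
  word_right : forall i, i <= N ->
    cut true d (grid_rank s i m) =1 [in (val (lambda s i m)).2];
  word_left : forall j, j <= m -> cut false d j =1 [in (val (lambda s N j)).2] }.

Lemma cut0 N t (d : rawdiag N) l : cut t d 0 l = false.
Proof. by apply/existsP => -[w]; rewrite /initial_nodes andbF. Qed.

Lemma word_diag0 N (s : 'S_N) : word_diag s 0 (id_diag N).
Proof.
split.
- exact: okada_valP.
- by move=> w; rewrite /= ffunE npos_mir; have := npos_lt w; lia.
- by move=> w _; rewrite /= !ffunE inordK // /nabs ltnS.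
- move=> i iN l; rewrite lambda0r; have -> : grid_rank s i 0 = 0.
    by apply: eq_card0 => k; rewrite !inE andbF.
  by rewrite cut0.
- by move=> j; rewrite leqn0 => /eqP -> l; rewrite cut0 lambda0r.
Qed.

Lemma grid_rank_mono N (s : 'S_N) i i' j : i <= i' -> grid_rank s i j <= grid_rank s i' j.
Proof.
move=> ii'; apply: subset_leq_card; apply/subsetP => k; rewrite !inE => /andP[ki ->].
by rewrite (leq_trans ki).
Qed.

Lemma word_diagS N (s : 'S_N) (m : 'I_N) (d0 d : rawdiag N) :
  word_diag s m d0 -> insertion d0 m (grid_rank s (s^-1%g m) m).+1 d -> word_diag s m.+1 d.
Proof.
move=> [_ _ _ right0 left0] [okd oddd idd _ leftd lowd atd highd].
have rightd i : i <= N -> cut true d (grid_rank s i m.+1) =1 [in (val (lambda s i m.+1)).2].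
  elim: i => [|i IHi] iN.
    have -> : grid_rank s 0 m.+1 = 0 by apply: eq_card0 => k; rewrite !inE.
    by move=> l; rewrite cut0.
  have [im|mi|im] := ltngtP i (s^-1%g m).
  - have rk : grid_rank s i.+1 m.+1 = grid_rank s i.+1 m.
      by rewrite grid_rankS_col ltnNge im addn0.
    rewrite (@lambda_col _ s i.+1 m) // rk => l; rewrite lowd ?right0 //.
    by rewrite ltnS grid_rank_mono.
  - pose k := Ordinal iN.
    have skm : s k != m.
      by apply/eqP => e; move: mi; rewrite -e permK ltnn.
    have [skm'|mk|/val_inj e] := ltngtP (s k) m; last by rewrite e eqxx in skm.
      have r1 : grid_rank s i.+1 m.+1 = grid_rank s i m.+1 + (s k < m.+1).
        exact: (grid_rankS_row s k).
      have r2 : grid_rank s i m.+1 = (grid_rank s i m).+1 by rewrite grid_rankS_col mi addn1.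
      (* The rank exceeds that of $\lambda(i,m)$ by two, which is both the shift in [highd] and the
         raise of rank in the growth rule. *)
      rewrite (@lambda_raise _ s k m) // r1 r2 (ltnW skm' : s k < m.+1) addn1 => l.
      rewrite highd ?subn2 /= ?right0 ?(ltnW iN) //; apply/andP; split.
        by rewrite !ltnS grid_rank_mono // ltnW.
      have := grid_rank_mono s m.+1 iN; rewrite r1 r2 (ltnW skm' : s k < m.+1) grid_rank_full //.
      by rewrite addn1.
    (* The point of this row is in a later column, so the column merely repeats a set. *)
    have -> : grid_rank s i.+1 m.+1 = grid_rank s i m.+1.
      by rewrite (grid_rankS_row s k) ltnS leqNgt mk addn0.
    by rewrite (@lambda_row _ s k m.+1) //; apply: IHi; exact: ltnW.
  - have := lambda_marked s (s^-1%g m); rewrite permKV im => -> l.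
    rewrite (grid_rankS_row s (s^-1%g m)) permKV ltnSn grid_rankS_col ltnn addn0 addn1 atd /=.
    rewrite right0; last by rewrite ltnW.
    by rewrite lambda_rank ?mem_rcons ?inE 1?orbC // ltnW.
split=> // j; rewrite leq_eqVlt => /orP[/eqP ->|jm] l.
  have := rightd N (leqnn N) l; rewrite grid_rank_full // => <-.
  exact: cut_balanced.
by rewrite leftd // left0.
Qed.

(** * Transfer to the algebra and conclusion *)

Local Open Scope ring_scope.

Lemma dmul_dbasis (K : fieldType) N (x : nat -> K) (C D M : okada N) :
  compose C D = val M -> (forall k, nloops C D k = 0%N) ->
  dmul x (dbasis K C) (dbasis K D) = dbasis K M.
Proof.
move=> cCD nl; apply/ffunP => M'; rewrite !ffunE big_mkcond (bigD1 (C, D)) //=.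
rewrite [X in _ + X]big1 ?addr0; last first.
  move=> [C' D'] /=; rewrite !ffunE xpair_eqE negb_and => /orP[] /negbTE ->;
  by case: ifP; rewrite ?mulr0 ?mul0r.
rewrite cCD !ffunE !eqxx !mul1r val_eqE [M' == M]eq_sym; case: eqP => //= _.
by rewrite big1 // => k _; rewrite nl.
Qed.

Lemma dstar_dbasis (K : fieldType) N (D : okada N) : dstar (dbasis K D) = dbasis K (mirror D).
Proof. by apply/ffunP => M; rewrite !ffunE (can2_eq (@mirrorK N) (@mirrorK N)). Qed.

Section Words.
Variables (K : fieldType) (N : nat) (x : nat -> K) (A : algType K) (E : nat -> A).
Variable Theta : {linear A -> dalg K N}.
Hypothesis Theta_iso : is_okada_iso x E Theta.

Lemma Theta_insertion (m c : nat) (D0 : okada N) (W : A) :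
  (m < N)%N -> (c <= m)%N -> Theta W = dbasis K D0 ->
  insertion D0 m m.+1 D0 ->
  exists2 D : okada N, insertion D0 m (m.+1 - c) D &
    Theta (W * \prod_(k < c) E (m - k)%N) = dbasis K D.
Proof.
case: Theta_iso => _ _ ThetaM ThetaE mN + ThetaW ins0.
elim: c => [|c IHc] cm; first by exists D0; rewrite ?subn0 // big_ord0 mulr1.
have [D insD ThetaD] := IHc (ltnW cm).
(* The next generator is $E_{m-c}$; its nodes $m-c$ and $m-c+1$ are the ordinals $m-c-1$ and
   $m-c$. *)
have aN : ((m - c).-1 < N)%N by lia.
have bN : (m - c < N)%N by lia.
have b_gen : (0 < m - c < N)%N by lia.
have [|||nl insD'] := @insertion_step N D0 D m (Ordinal aN) (Ordinal bN); rewrite /=.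
- by lia.
- by rewrite leq_subr.
- by rewrite -subSn // ltnW.
have okD' := insertion_okada insD'.
exists (Okada okD'); first by rewrite subSS.
rewrite big_ord_recr /= mulrA ThetaM ThetaD ThetaE.
exact: (@dmul_dbasis _ _ _ D (gen_diag b_gen) (Okada okD')).
Qed.

Lemma Theta_word (s : 'S_N) : exists2 D : okada N,
  word_diag s N D & Theta (okada_word s E) = dbasis K D.
Proof.
case: (Theta_iso) => _ Theta1 _ _.
suff word m (mN : (m <= N)%N) : exists2 D : okada N, word_diag s m D &
    Theta (\prod_(i < m) \prod_(k < inv_code s (widen_ord mN i)) E (i - k)%N) = dbasis K D.
  have [D wD ThetaD] := word N (leqnn N); exists D => //; rewrite -ThetaD; congr (Theta _).
  by apply: eq_bigr => i _; have -> : widen_ord (leqnn N) i = i by apply: val_inj.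
elim: m mN => [|m IHm] mN.
  by exists (id_diag N); [exact: word_diag0 | rewrite big_ord0].
have [D wD ThetaD] := IHm (ltnW mN).
pose M := Ordinal mN.
have insD : insertion D m m.+1 D by case: (wD) => okD oddD idD _ _; exact: insertion_start.
have rk := inv_code_rank s M.
have [|D' insD' ThetaD'] := @Theta_insertion m (inv_code s M) D _ mN _ ThetaD insD.
  by rewrite -[m]/(M : nat) -rk leq_addr.
exists D'.
  apply: (@word_diagS N s M D D') => //.
  by have <- : (m.+1 - inv_code s M)%N = (grid_rank s (s^-1%g M) M).+1 by move: rk => /=; lia.
rewrite big_ord_recr /= -ThetaD'; congr (Theta (_ * _)).
  apply: eq_bigr => i _.
  by have -> : widen_ord mN (widen_ord (leqnSn m) i) = widen_ord (ltnW mN) i by apply: val_inj.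
by have -> : widen_ord mN ord_max = M by apply: val_inj.
Qed.

End Words.

Theorem theorem4p6 (N : nat) (N_gt0 : (0 < N)%N) (K : fieldType) (x : nat -> K)
    (A : algType K) (E : nat -> A) (A_okada : is_okada_algebra N x E)
    (Theta : {linear A -> dalg K N}) (Theta_iso : is_okada_iso x E Theta)
    (s : 'S_N) :
  exists (L R : halfdiag N) (LR RL : okada N),
    [/\ is_fomin_left s L, is_fomin_right s R, is_join L R LR & is_join R L RL] /\
    [/\ Theta (okada_word s E) = dbasis K LR,
        dstar (Theta (okada_word s E)) = Theta (okada_word (s^-1)%g E)
      & Theta (okada_word (s^-1)%g E) = dbasis K RL].
Proof.
have cuts (t : 'S_N) (D : okada N) : word_diag t N D -> forall i, (i <= N)%N ->
    half_cut (left_half D) i =1 [in (val (lambda t N i)).2] /\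
    half_cut (right_half D) i =1 [in (val (lambda t i N)).2].
  move=> [okD oddD _ rightD leftD] i iN; split=> l; rewrite half_cut_left_half ?okada_valP //.
    exact: leftD.
  by rewrite cut_mirror -rightD // grid_rank_full_col.
have [D wD ThetaD] := Theta_word Theta_iso s.
have [D' wD' ThetaD'] := Theta_word Theta_iso (s^-1)%g.
have halves (t : 'S_N) (F : okada N) : word_diag t N F ->
    is_half (left_half F) /\ is_half (right_half F).
  move=> [okF oddF _ _ _]; split; first exact: is_half_left_half.
  by apply: is_half_left_half; [exact: okada_valP | exact: odd_arcs_mirror].
have [hL hR] := halves _ _ wD; have [hL' hR'] := halves _ _ wD'.
(* Inverting the permutation transposes the growth diagram and so exchanges the two chains, just as
   the mirror exchanges the two halves. *)
have D'E : D' = mirror D.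
  apply: okada_join_inj; apply: half_inj => //; rewrite /right_half ?mirrorK // => i iN l.
    by rewrite (cuts _ _ wD' i iN).1 (cuts _ _ wD i iN).2 lambda_inv.
  by rewrite (cuts _ _ wD' i iN).2 (cuts _ _ wD i iN).1 lambda_inv.
exists (Half hL), (Half hR), D, (mirror D); split; last first.
  by split; rewrite ?ThetaD ?ThetaD' ?dstar_dbasis ?D'E.
split.
- apply: has_chain_unique; apply: has_chain_half_cut => i iN.
  split; last exact: (cuts _ _ wD i iN).1.
  by rewrite lambda_rank // grid_rank_full.
- apply: has_chain_unique; apply: has_chain_half_cut => i iN.
  split; last exact: (cuts _ _ wD i iN).2.
  by rewrite lambda_rank // grid_rank_full_col.
- exact: is_join_halves.
- by apply: is_join_halves; rewrite /right_half ?mirrorK.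
Qed.
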